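(* Let $\{M_1(t)\}_{t\ge0},\dots,\{M_q(t)\}_{t\ge0}$ be $q$ independent GCPs such that, for each $1\le i\le q$, $\{M_i(t)\}_{t\ge0}$ performs $k_i$ kinds of jumps of amplitude $1,\dots,k_i$ with positive rates $\lambda_1^{(i)},\dots,\lambda_{k_i}^{(i)}$, where $k_1\le\cdots\le k_q$, and put $\lambda_j^{(i)}=0$ for $j>k_i$. Let $\mathscr{M}^q(t)=M_1(t)+\dots+M_q(t)$, let $A_i(t)$ be the number of packets of jumps registered by time $t$ in $\{\mathscr{M}^q(t)\}_{t\ge0}$ from the component $\{M_i(t)\}_{t\ge0}$, let $\mathscr{A}^q(t)$ be the number of packets of jumps registered in $\{\mathscr{M}^q(t)\}_{t\ge0}$ by time $t$, and let $\lambda^{(i)}=\lambda_1^{(i)}+\dots+\lambda_{k_i}^{(i)}$. Then: (1) For each $1\le i\le q$, $\mathbb{E}(u^{A_i(t)})=e^{-\lambda^{(i)}t(1-u)}$ for $|u|\le1$, $t\ge0$; the processes $\{A_i(t)\}_{t\ge0}$, $1\le i\le q$, are independent Poisson processes with rates $\lambda^{(i)}$, respectively. (2) $\{\mathscr{A}^q(t)\}_{t\ge0}$ is a Poisson process with rate $\sum_{i=1}^{q}\lambda^{(i)}$. (3) For $t>0$ and integers $0\le a\le b$, $$\mathrm{Pr}\{A_i(t)=a\mid\mathscr{A}^q(t)=b\}=\frac{b!}{a!(b-a)!}\,\frac{(\lambda^{(i)})^a}{\big(\sum_{j=1}^{q}\lambda^{(j)}\big)^b}\Big(\sum_{j\ne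 i}\lambda^{(j)}\Big)^{b-a},$$ that is, conditionally on $\mathscr{A}^q(t)=b$, $A_i(t)$ is binomial with parameters $b$ and $\lambda^{(i)}/\sum_{j=1}^{q}\lambda^{(j)}$. (4) For $t\ge0$, $\mathbb{E}(A_i(t)\mathscr{M}^q(t))=\sum_{j=1}^{k_i}j\lambda_j^{(i)}t+\lambda^{(i)}\sum_{l=1}^{k_q}\sum_{k=1}^{q}l\lambda_l^{(k)}t^2$ and $\operatorname{Cov}(A_i(t),\mathscr{M}^q(t))=\sum_{j=1}^{k_i}j\lambda_j^{(i)}t$, and for $t>0$ $$\operatorname{Corr}(A_i(t),\mathscr{M}^q(t))=\frac{\sum_{j=1}^{k_i}j\lambda_j^{(i)}}{\sqrt{\lambda^{(i)}}\sqrt{\sum_{j=1}^{k_q}\sum_{m=1}^{q}j^2\lambda_j^{(m)}}}.$$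
   Context: A counting process is an $\mathbb{N}_0$-valued process with nondecreasing right-continuous paths. A generalized counting process (GCP) performing $k$ kinds of jumps of amplitude $1,2,\dots,k$ with positive rates $\lambda_1,\dots,\lambda_k$ is a counting process $\{M(t)\}_{t\ge0}$ with $M(0)=0$ and independent and stationary increments such that, as $h\to0^+$, $\mathrm{Pr}\{M(t+h)=n+j\mid M(t)=n\}$ equals $1-\sum_{i=1}^k\lambda_i h+o(h)$ for $j=0$, $\lambda_jh+o(h)$ for $1\le j\le k$, and $o(h)$ for $j\ge k+1$. A ''packet of jumps'' of a process is a single jump event of whatever size: the number of packets of jumps registered by time $t$ is the number of instants in $(0,t]$ at which the path jumps, and $A_i(t)$ counts the jump instants of $\{M_i(t)\}_{t\ge0}$ in $(0,t]$. Convention: $0^0=1$. *)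

(* Defs.v *)
From HB Require Import structures.
From mathcomp Require Import all_boot all_order all_algebra finmap.
From mathcomp Require Import all_classical all_reals all_analysis.

Set Implicit Arguments.
Unset Strict Implicit.
Unset Printing Implicit Defensive.

Import Order.TTheory GRing.Theory Num.Theory.
Import numFieldNormedType.Exports.

Local Open Scope classical_set_scope.
Local Open Scope ring_scope.

Section Independence.
Context d (T : measurableType d) (R : realType) (P : probability T R).

(* Pr(A | B), to be read only when P B != 0. *)
Definition cond_pr (A B : set T) : R := fine (P (A `&` B)) / fine (P B).

Definition independent_classes (I : finType) (F : I -> set_system T) :=
  forall (J : {set I}) (E : I -> set T), (forall i, i \in J -> F i (E i)) ->
    P (\bigcap_(i in [set` J]) E i) = (\prod_(i in J) P (E i))%E.

Definition independent_rvs (I : finType) (X : I -> T -> nat) :=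
  independent_classes (fun i => preimage_set_system setT (X i) measurable).

(* The sigma-algebra generated by the variables X t, t >= 0. *)
Definition process_sigma (X : R -> T -> nat) : set_system T :=
  <<s \bigcup_(t in [set t : R | 0 <= t])
        preimage_set_system setT (X t) measurable >>.

Definition independent_processes (I : finType) (X : I -> R -> T -> nat) :=
  independent_classes (fun i => process_sigma (X i)).

Definition correlation (X Y : T -> R) : R :=
  fine (covariance P X Y) /
    (Num.sqrt (fine (variance P X)) * Num.sqrt (fine (variance P Y))).

End Independence.

(* A process {X(t)}, t >= 0, is represented by X : R -> T -> nat; only its
   values at nonnegative times are ever constrained or used.  The type nat
   carries its discrete topology and discrete sigma-algebra. *)
Section Processes.
Context d (T : measurableType d) (R : realType) (P : probability T R).
Implicit Type X : R -> T -> nat.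

Definition counting_process X :=
  [/\ forall t : R, 0 <= t -> measurable_fun setT (X t),
      forall w (s t : R), 0 <= s -> s <= t -> (X s w <= X t w)%N
    & forall w (t : R), 0 <= t -> X u w @[u --> t^'+] --> X t w].

Definition independent_increments X :=
  forall (n : nat) (t : nat -> R),
    0 <= t 0 -> (forall j, (j < n)%N -> t j <= t j.+1) ->
    independent_rvs P (fun (j : 'I_n) w => (X (t j.+1) w - X (t j) w)%N).

Definition stationary_increments X :=
  forall s s' h : R, 0 <= s -> 0 <= s' -> 0 <= h -> forall U : set nat,
    P [set w | U (X (s + h)%R w - X s w)%N] =
    P [set w | U (X (s' + h)%R w - X s' w)%N].

Definition total_rate (k : nat) (lam : nat -> R) : R :=
  \sum_(1 <= j < k.+1) lam j.

(* The amplitudes 1, ..., k have rates lam 1, ..., lam k; no other value of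
   lam is used. *)
Definition generalized_counting_process (k : nat) (lam : nat -> R) X :=
  [/\ (0 < k)%N /\ (forall j, (1 <= j <= k)%N -> 0 < lam j),
      counting_process X,
      forall w, X 0 w = 0%N,
      independent_increments X /\ stationary_increments X
    & forall (t : R) (n : nat), 0 <= t -> P [set w | X t w = n] != 0%E ->
      let p (j : nat) (h : R) :=
        cond_pr P [set w | X (t + h) w = (n + j)%N] [set w | X t w = n] in
      [/\ (fun h => p 0%N h - (1 - total_rate k lam * h))
            =o_ ((0 : R)^'+) (fun h => h),
          forall j, (1 <= j <= k)%N ->
            (fun h => p j h - lam j * h) =o_ ((0 : R)^'+) (fun h => h)
        & forall j, (k < j)%N -> p j =o_ ((0 : R)^'+) (fun h => h)]].

(* The second argument of poisson_prob is unused by the library; the law is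
   the Poisson law with mean its first argument, and the Dirac mass at 0 when
   that mean is 0. *)
Definition poisson_process (rate : R) X :=
  [/\ 0 < rate,
      counting_process X,
      forall w, X 0 w = 0%N,
      independent_increments X
    & forall s t : R, 0 <= s -> s <= t -> forall U : set nat,
      P [set w | U (X t w - X s w)%N] = poisson_prob (rate * (t - s)) 0 U].

(* For a nondecreasing right-continuous path, the jump instants are the times
   s > 0 at which the left limit differs from the value. *)
Definition jump_instant (f : R -> nat) (s : R) :=
  ~ (f u @[u --> s^'-] --> f s).

(* The number of packets of jumps registered by time t.  The set below is
   finite on every path of a counting process, so the default value of
   fset_set on infinite sets is irrelevant. *)
Definition jump_count X (t : R) (w : T) : nat :=
  #|` fset_set [set s : R | 0 < s <= t /\ jump_instant (X ^~ w) s] |.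

Definition sum_process (q : nat) (M : 'I_q -> R -> T -> nat) : R -> T -> nat :=
  fun t w => (\sum_(i < q) M i t w)%N.

End Processes.

(* Main.v *)
Require Import Defs.
From HB Require Import structures.
From mathcomp Require Import all_boot all_order all_algebra finmap.
From mathcomp Require Import all_classical all_reals all_analysis.
From mathcomp Require Import measurable_realfun ring lra zify.

(* On each path, cutting (s, t] into 2^n equal cells and counting the cells on
   which the process increases gives, for n large, exactly the number of jumps
   in (s, t].  Under independent increments whose probability of being nonzero
   over a time h is L h + o(h), that count is binomial and converges to a
   Poisson law; independence of the increments of the jump count, and its
   measurability with respect to the process, pass to the limit as well.
   This applies to each M_i and to any partial sum of the M_i, whose rate is
   the sum of the rates.  Two components increase in a common cell with
   probability O(4^-n), so almost surely they never jump together and the jump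
   count of a partial sum is the sum of the jump counts; this gives the
   binomial conditional law.
   For the moments, increments over cells are truncated at c.  The truncated
   sums are monotone in n; their first moments and mixed second moments follow
   from the rates.  They tend to A_i(t) for c = 1 and, since almost surely no
   jump exceeds k_i, to M_i(t) for c = k_i.  Monotone convergence then yields
   every expectation that is needed. *)

Set Implicit Arguments.
Unset Strict Implicit.
Unset Printing Implicit Defensive.

Import Order.TTheory GRing.Theory Num.Theory.
Import numFieldNormedType.Exports.

Local Open Scope classical_set_scope.
Local Open Scope ring_scope.

(** * Jumps of counting paths *)

Section CountingPaths.
Context {R : realType}.
Implicit Types (f : R -> nat) (s t u r : R).

(** The rates fix probabilities only up to o(h) and do not bound the values above [k], so neither
    the law of a jump count nor the finiteness of a moment can be read off them. Everything is
    therefore computed on a grid, where truncation leaves finitely many values, and then carried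
    over. With equal cells, stationarity gives all cells of a level the same probability; halving
    makes the grids nested, which is the source of monotonicity. As the variables are integers, the
    sums almost surely become equal to their limit, so indicators of events converge and
    probabilities pass to the limit. The property [has_jump_rate] isolates what the Poisson limit
    needs; it is stable under independent sums, which spares proving that a sum of GCPs is a GCP.
    For the conditional law, the total count is replaced, off a null set, by the count of component
    [i] plus those of the others, which are independent of it. *)

Definition counting_path f :=
  (forall s t, 0 <= s -> s <= t -> (f s <= f t)%N) /\
  (forall t, 0 <= t -> f u @[u --> t^'+] --> f t).

Definition jumps f s t := [set r : R | s < r <= t /\ jump_instant f r].

Definition jumpn f s t := #|` fset_set (jumps f s t)|.

Variable f : R -> nat.
Hypothesis fP : counting_path f.

Lemma path_le s t : 0 <= s -> s <= t -> (f s <= f t)%N.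
Proof. exact: (proj1 fP). Qed.

(** In the discrete space [nat] a singleton is a neighbourhood of its point, so right continuity
    means being constant just after [t]. *)
Lemma path_right_const t : 0 <= t ->
  exists2 e : R, 0 < e & forall u, t <= u < t + e -> f u = f t.
Proof.
move=> t0; have /(_ _ (discrete_set1 (f t))) := proj2 fP t t0.
rewrite /fmap/= /nbhs/= => -[e /= e0 he]; exists e => // u /andP[].
rewrite le_eqVlt => /predU1P[<-//|tu ut]; apply: he => //=.
by rewrite distrC ger0_norm ?subr_ge0 1?ltW// ltrBlDl.
Qed.

(** If [f u = f r] for one earlier [u], monotonicity freezes [f] on [u, r] and the left limit is
    [f r]; conversely, a limit in a discrete space is eventually attained. *)
Lemma jump_instantP r : 0 < r ->
  jump_instant f r <-> (forall u, 0 <= u < r -> (f u < f r)%N).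
Proof.
move=> r0; split.
  move=> jr u /andP[u0 ur]; rewrite ltn_neqAle path_le ?(ltW ur)// andbT.
  apply/eqP => fur; apply: jr.
  apply: (@cvg_trans _ (f r @[_ --> r^'-])); last exact: cvg_cst.
  apply: near_eq_cvg; near=> v.
  have uv : u < v by near: v; exact: nbhs_left_gt.
  have vr : v < r by near: v; exact: nbhs_left_lt.
  apply/eqP; rewrite eqn_leq -{1}fur path_le ?(ltW uv)//=.
  by rewrite path_le ?(ltW vr)// (le_trans u0 (ltW uv)).
move=> H /(_ _ (discrete_set1 (f r))) H1.
have : \forall v \near r^'-, False.
  near=> v.
  have v0 : 0 < v by near: v; exact: nbhs_left_gt.
  have vr : v < r by near: v; exact: nbhs_left_lt.
  have := H v; rewrite (ltW v0) vr => /(_ isT).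
  by have -> : f v = f r; [near: v|rewrite ltnn].
by move/filter_ex => -[].
Unshelve. all: by end_near. Qed.

(** When the path grows, the witness is the first time at which the final value [f t] is reached:
    right continuity shows that this infimum is attained, and [f s < f t] keeps it away from [s]. *)
Lemma jumps_lt s t : 0 <= s -> s <= t ->
  (f s < f t)%N <-> jumps f s t !=set0.
Proof.
move=> s0 st; split; last first.
  move=> [r [/andP[sr rt] /jump_instantP]].
  move=> /(_ (le_lt_trans s0 sr) s); rewrite s0 sr => /(_ isT) h.
  by rewrite (leq_trans h)// path_le// (le_trans s0 (ltW sr)).
move=> fst.
pose A := [set u | s <= u <= t /\ f u = f t].
have At : A t by split=> //; rewrite st lexx.
have lA : lbound A s by move=> u [/andP[]].
have hA : has_inf A by split; [exists t|exists s].
have sr : s <= inf A by exact: lb_le_inf (ex_intro _ t At) lA.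
have rt : inf A <= t by apply: ge_inf => //; exists s.
have r0 : 0 <= inf A by exact: le_trans sr.
have [e e0 he] := path_right_const r0.
have frt : f (inf A) = f t.
  have [u [/andP[su ut] fu] ur] := inf_adherent e0 hA.
  rewrite -fu; apply/esym/he; rewrite ur andbT.
  by apply: ge_inf; [exists s|split=> //; rewrite su].
have {}sr : s < inf A.
  rewrite lt_neqAle sr andbT; apply: contraTneq fst => ->.
  by rewrite frt ltnn.
exists (inf A); split; first by rewrite sr.
apply/jump_instantP; first exact: le_lt_trans sr.
move=> u /andP[u0 ur]; rewrite ltn_neqAle path_le ?(ltW ur)// andbT.
apply/eqP => fur.
have [us|su] := ltP u s.
  have := path_le u0 (ltW us); rewrite fur frt leqNgt => /negP; exact.
have : A u.
  by rewrite /A/= su (le_trans (ltW ur) rt); split=> //; rewrite fur frt.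
move=> /(ge_inf (ex_intro _ s lA)); rewrite leNgt => /negP; exact.
Qed.

(** The path strictly increases at each jump, so [f] is injective on the jump instants and embeds
    them into the integers up to [f t]. *)
Lemma finite_jumps s t : 0 <= s -> finite_set (jumps f s t).
Proof.
move=> s0; have inj : set_inj (jumps f s t) f.
  move=> x y /set_mem[/andP[sx xt] /jump_instantP jx].
  move=> /set_mem[/andP[sy yt] /jump_instantP jy] fxy.
  have [x0 y0] : 0 < x /\ 0 < y by split; exact: le_lt_trans s0 _.
  have [xy|yx|//] := ltgtP x y.
    by have := jy y0 x; rewrite fxy ltnn (ltW x0) xy => /(_ isT).
  by have := jx x0 y; rewrite fxy ltnn (ltW y0) yx => /(_ isT).
rewrite -(eq_finite_set (inj_card_eq inj)).
apply: (@sub_finite_set _ _ `I_(f t).+1); last exact: finite_II.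
move=> _ [x [/andP[sx xt] _] <-] /=; rewrite ltnS path_le//.
by rewrite (le_trans s0)// ltW.
Qed.

Lemma jumpnD s t u : 0 <= s -> s <= t -> t <= u ->
  (jumpn f s t + jumpn f t u)%N = jumpn f s u.
Proof.
move=> s0 st tu; have t0 := le_trans s0 st.
have jE : jumps f s u = jumps f s t `|` jumps f t u.
  apply/seteqP; split => [r [/andP[sr ru] jr]|r [|] [/andP[sr ru] jr]].
  - have [rt|tr] := leP r t; first by left; split=> //; rewrite sr.
    by right; split=> //; rewrite tr.
  - by split=> //; rewrite sr (le_trans ru).
  - by split=> //; rewrite ru (le_lt_trans st).
rewrite /jumpn jE fset_setU; [|exact: finite_jumps..].
rewrite -cardfsUI -fset_setI; [|exact: finite_jumps..].
rewrite (_ : _ `&` _ = set0) ?fset_set0 ?cardfs0 ?addn0//.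
apply/seteqP; split=> // r [[/andP[_ rt] _] [/andP[tr _] _]] /=.
by move: (le_lt_trans rt tr); rewrite ltxx.
Qed.

Lemma jumpn_gt0 s t : 0 <= s -> s <= t -> (0 < jumpn f s t)%N = (f s < f t)%N.
Proof.
move=> s0 st; rewrite cardfs_gt0.
apply/idP/idP => [/fset0Pn[x]|].
  rewrite in_fset_set; last exact: finite_jumps.
  by move=> /set_mem jx; apply/jumps_lt => //; exists x.
move=> /(jumps_lt s0 st)[x jx]; apply/fset0Pn; exists x.
by rewrite in_fset_set; [exact/mem_set|exact: finite_jumps].
Qed.

(** The bridge from increments to jumps: truncated at 1, both record only whether the path moved. *)
Lemma jumpn_min1 s t : 0 <= s -> s <= t ->
  minn (f t - f s) 1 = minn (jumpn f s t) 1.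
Proof.
move=> s0 st; have := jumpn_gt0 s0 st; have := path_le s0 st.
by rewrite !minnE; lia.
Qed.

Lemma min_pos_seq (l : seq R) : (forall x, x \in l -> 0 < x) ->
  exists2 e : R, 0 < e & forall x, x \in l -> e <= x.
Proof.
elim: l => [_|x l IH H]; first by exists 1.
have [|e e0 he] := IH; first by move=> y yl; apply: H; rewrite inE yl orbT.
exists (Num.min e x); first by rewrite lt_min e0 H// inE eqxx.
move=> y; rewrite inE => /predU1P[->|/he ey]; rewrite ge_min ?lexx ?orbT//.
by rewrite ey.
Qed.

(** [e] is a lower bound for the finitely many positive distances between jump instants in (s, t];
    two jumps in a shorter interval would violate it. *)
Lemma jumpn_mesh s t : 0 <= s -> exists2 e : R, 0 < e &
  forall a b, s <= a -> b <= t -> b - a < e -> (jumpn f a b <= 1)%N.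
Proof.
move=> s0; pose D : seq R := fset_set (jumps f s t).
have [|e e0 he] := @min_pos_seq
    [seq x <- [seq `|x - y| | x <- D, y <- D] | 0 < x].
  by move=> x; rewrite mem_filter => /andP[].
exists e => // a b sa bt bae.
have ab0 : finite_set (jumps f a b) by apply: finite_jumps; exact: le_trans sa.
rewrite leqNgt; apply/negP => jab.
have /fset0Pn[x xab] : fset_set (jumps f a b) != fset0.
  by rewrite -cardfs_gt0; exact: ltnW.
have /fset0Pn[y] : (fset_set (jumps f a b) `\ x)%fset != fset0.
  by rewrite -cardfs_gt0; move: jab; rewrite /jumpn (cardfsD1 x) xab.
rewrite in_fsetD1 => /andP[yx].
move: xab; rewrite !in_fset_set// => /set_mem[/andP[ax xb] jx].
move=> /set_mem[/andP[ay yb] jy].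
have : e <= `|x - y|.
  apply: he; rewrite mem_filter normr_gt0 subr_eq0 eq_sym yx/=.
  apply/allpairsP; exists (x, y); split=> //; rewrite /= in_fset_set;
    try exact: finite_jumps; apply/mem_set; split=> //.
    by rewrite (le_lt_trans sa ax) (le_trans xb).
  by rewrite (le_lt_trans sa ay) (le_trans yb).
by rewrite leNgt => /negP; apply; rewrite ltr_norml; apply/andP; split; lra.
Qed.

End CountingPaths.

(** * Truncated increments over dyadic grids *)

Section DyadicSums.
Context {R : realType}.
Implicit Types (f : R -> nat) (s t : R).

Definition grid s t n j : R := s + (t - s) * (j%:R / (2 ^ n)%:R).

Lemma grid0 s t n : grid s t n 0 = s.
Proof. by rewrite /grid mul0r mulr0 addr0. Qed.

Lemma natr_exp2_gt0 n : 0 < (2 ^ n)%:R :> R.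
Proof. by rewrite ltr0n expn_gt0. Qed.

Lemma natr_exp2_neq0 n : (2 ^ n)%:R != 0 :> R.
Proof. by rewrite gt_eqF// natr_exp2_gt0. Qed.

Lemma gridE s t n : grid s t n (2 ^ n) = t.
Proof. by rewrite /grid divff ?natr_exp2_neq0// mulr1 addrC subrK. Qed.

Lemma grid_le s t n i j : s <= t -> (i <= j)%N -> grid s t n i <= grid s t n j.
Proof.
move=> st ij; rewrite lerD2l ler_wpM2l ?subr_ge0//.
by rewrite ler_pM2r ?invr_gt0 ?natr_exp2_gt0// ler_nat.
Qed.

Lemma grid_ge s t n i : s <= t -> s <= grid s t n i.
Proof. by move=> st; rewrite -{1}(grid0 s t n) grid_le. Qed.

Lemma grid_le_end s t n i : s <= t -> (i <= 2 ^ n)%N -> grid s t n i <= t.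
Proof. by move=> st i2; rewrite -{2}(gridE s t n) grid_le. Qed.

Lemma gridB s t n j : grid s t n j.+1 - grid s t n j = (t - s) / (2 ^ n)%:R.
Proof. by rewrite /grid -natr1; field; rewrite natr_exp2_neq0. Qed.

Lemma grid_double s t n j : grid s t n.+1 j.*2 = grid s t n j.
Proof.
rewrite /grid expnS -muln2 !natrM; field; exact: natr_exp2_neq0.
Qed.

(* On a counting path these sums increase with n to the sum over the jumps of
   min(jump size, c): the number of jumps for c = 1, and the whole increment
   when no jump exceeds c. *)
Definition dyadic_sum (c : nat) f s t n : nat :=
  \sum_(j < 2 ^ n) minn (f (grid s t n j.+1) - f (grid s t n j)) c.

Lemma sum_telescope_le f s t n c m : counting_path f -> 0 <= s -> s <= t ->
  (\sum_(j < m) minn (f (grid s t n j.+1) - f (grid s t n j)) c <=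
   f (grid s t n m) - f (grid s t n 0))%N.
Proof.
move=> fP s0 st; elim: m => [|m IH]; first by rewrite big_ord0.
rewrite big_ord_recr/=.
have g0 i : 0 <= grid s t n i by rewrite (le_trans s0) ?grid_ge.
have := path_le fP (g0 m) (grid_le n st (leqnSn m)).
have := path_le fP (g0 0%N) (grid_le n st (leq0n m)).
rewrite minnE; move: (\sum_(_ < _) _)%N IH => S; lia.
Qed.

Lemma dyadic_sum_le f s t n c : counting_path f -> 0 <= s -> s <= t ->
  (dyadic_sum c f s t n <= f t - f s)%N.
Proof.
by move=> fP s0 st; have := sum_telescope_le n c (2 ^ n) fP s0 st;
  rewrite grid0 gridE.
Qed.

Lemma dyadic_sumS f s t n c : counting_path f -> 0 <= s -> s <= t ->
  (dyadic_sum c f s t n <= dyadic_sum c f s t n.+1)%N.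
Proof.
move=> fP s0 st; rewrite /dyadic_sum expnS mul2n.
have split2 (F : nat -> nat) m :
    (\sum_(j < m.*2) F j = \sum_(j < m) (F j.*2 + F j.*2.+1))%N.
  by elim: m => [|m IH]; rewrite ?big_ord0// doubleS !big_ord_recr/= IH addnA.
rewrite (split2 (fun j => minn (f (grid s t n.+1 j.+1) - f (grid s t n.+1 j)) c)).
apply: leq_sum => j _; rewrite -(grid_double s t n j.+1) -(grid_double s t n j) doubleS.
have g0 i : 0 <= grid s t n.+1 i by rewrite (le_trans s0) ?grid_ge.
have := path_le fP (g0 j.*2) (grid_le n.+1 st (leqnSn _)).
have := path_le fP (g0 j.*2.+1) (grid_le n.+1 st (leqnSn _)).
by rewrite !minnE; lia.
Qed.

(** Once the mesh is below the smallest gap between jumps, each cell holds at most one jump, and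
    truncation at 1 counts it exactly. *)
Lemma dyadic_sum_cvg f s t : counting_path f -> 0 <= s -> s <= t ->
  \forall n \near \oo, dyadic_sum 1 f s t n = jumpn f s t.
Proof.
move=> fP s0 st; have [e e0 he] := jumpn_mesh fP t s0.
near=> n.
have mesh : (t - s) / (2 ^ n)%:R < e.
  rewrite ltr_pdivrMr ?natr_exp2_gt0// -ltr_pdivrMl//.
  (* As [n < 2 ^ n], it is enough that [n] exceed the ratio of [t - s] to [e]. *)
  apply: (@lt_le_trans _ _ n%:R).
    by near: n; exact: nbhs_infty_gtr.
  by rewrite ler_nat ltnW// ltn_expl.
have g0 i : 0 <= grid s t n i by rewrite (le_trans s0) ?grid_ge.
have H m : (m <= 2 ^ n)%N ->
    (\sum_(j < m) minn (f (grid s t n j.+1) - f (grid s t n j)) 1)%N =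
    jumpn f s (grid s t n m).
  elim: m => [|m IH] m2.
    rewrite big_ord0 grid0; apply/esym/eqP.
    by rewrite -leqn0 leqNgt (jumpn_gt0 fP)// ltnn.
  rewrite big_ord_recr/= IH; last exact: ltnW.
  rewrite (jumpn_min1 fP) ?grid_le//.
  rewrite (minn_idPl _); last first.
    by apply: he; rewrite ?grid_ge ?grid_le_end// gridB.
  by rewrite (jumpnD fP)// ?grid_ge ?grid_le.
by rewrite /dyadic_sum H// gridE.
Unshelve. all: by end_near. Qed.

Lemma counting_path_jumpn f : counting_path f -> counting_path (jumpn f 0).
Proof.
move=> fP; split=> [s t s0 st|t t0].
  by rewrite -(jumpnD fP (lexx 0) s0 st) leq_addr.
have [e e0 he] := path_right_const fP t0.
apply: (@cvg_trans _ (jumpn f 0 t @[_ --> t^'+])); last exact: cvg_cst.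
apply: near_eq_cvg; near=> v.
have tv : t < v by near: v; exact: nbhs_right_gt.
have vt : v < t + e by near: v; apply: nbhs_right_lt; rewrite ltrDl.
rewrite -(jumpnD fP (lexx 0) t0 (ltW tv)) -[LHS]addn0; congr addn.
apply/esym/eqP; rewrite -leqn0 leqNgt (jumpn_gt0 fP) ?(ltW tv)//.
by rewrite he ?ltnn// (ltW tv).
Unshelve. all: by end_near. Qed.

End DyadicSums.

(** * Independence of natural-valued variables *)

Section NatVariables.
Context d (T : measurableType d).
Implicit Types (X Y : T -> nat).

Lemma measurable_nat_preimage X (U : set nat) :
  measurable_fun setT X -> measurable [set w | U (X w)].
Proof. by move=> mX; rewrite -[X in measurable X]setTI; exact: mX. Qed.

Lemma measurable_nat_comp X (h : nat -> nat) :
  measurable_fun setT X -> measurable_fun setT (fun w => h (X w)).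
Proof.
by move=> mX _ /= U _; rewrite setTI; exact: (@measurable_nat_preimage _ (h @^-1` U)).
Qed.

(** Slicing along the countably many values of [X] handles an arbitrary relation without a product
    sigma-algebra. *)
Lemma measurable_fun_nat_rel (r : nat -> nat -> Prop) X Y :
  measurable_fun setT X -> measurable_fun setT Y ->
  measurable [set w | r (X w) (Y w)].
Proof.
move=> mX mY.
rewrite (_ : [set w | _] = \bigcup_n ([set w | X w = n] `&` [set w | r n (Y w)])).
  apply: bigcup_measurable => n _; apply: measurableI.
    exact: (measurable_nat_preimage [set n]).
  exact: measurable_nat_preimage.
by apply/seteqP; split => w /=; [exists (X w)|move=> [n _ [<-]]].
Qed.

Lemma measurable_fun_muln X Y : measurable_fun setT X ->
  measurable_fun setT Y -> measurable_fun setT (fun w => X w * Y w)%N.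
Proof.
move=> mX mY _ U _; rewrite setTI.
exact: (measurable_fun_nat_rel (fun a b => U (a * b)%N) mX mY).
Qed.

Lemma measurable_fun_sumn (I : Type) (r : seq I) (p : pred I) (X : I -> T -> nat) :
  (forall i, measurable_fun setT (X i)) ->
  measurable_fun setT (fun w => \sum_(i <- r | p i) X i w)%N.
Proof.
move=> mX; elim: r => [|i r IH].
  by under eq_fun do rewrite big_nil; exact: measurable_cst.
under eq_fun do rewrite big_cons.
by case: (p i) => //; exact: measurable_fun_addn.
Qed.

Lemma measurable_all_fin (I : finType) (A : I -> set T) :
  (forall i, measurable (A i)) -> measurable [set w | forall i, A i w].
Proof.
move=> mA; rewrite (_ : [set w | _] = \bigcap_(i in [set: I]) A i).
  by apply: fin_bigcap_measurable.
by apply/seteqP; split => [w H i _|w H i]; exact: H.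
Qed.

End NatVariables.

Section Independence.
Context d (T : measurableType d) (R : realType) (P : probability T R).
Local Open Scope ereal_scope.

Lemma prob_fin (A : set T) : measurable A -> P A \is a fin_num.
Proof. by move=> mA; exact: fin_num_measure. Qed.

Lemma prod_prob_fin (I : finType) (p : pred I) (A : I -> set T) :
  (forall i, measurable (A i)) -> \prod_(i | p i) P (A i) \is a fin_num.
Proof.
move=> mA; elim/big_rec: _ => // i x _ xf.
by rewrite fin_numM// prob_fin.
Qed.

Lemma measure_nat_decomposition (mu : {measure set T -> \bar R})
    (X : T -> nat) (A : set T) : measurable_fun setT X -> measurable A ->
  mu A = \sum_(n <oo) mu (A `&` [set w | X w = n]).
Proof.
move=> mX mA.
have mF n : measurable (A `&` [set w | X w = n]).
  by apply: measurableI => //; exact: (measurable_nat_preimage [set n]).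
rewrite -measure_semi_bigcup//; last exact: bigcup_measurable.
  congr (mu _); apply/seteqP; split => [w Aw|w [n _ []]//].
  by exists (X w).
by move=> i j _ _ [w [[_ <-] [_ <-]]].
Qed.

Lemma prob_nat_decomposition (X : T -> nat) (A : set T) :
  measurable_fun setT X -> measurable A ->
  P A = \sum_(n <oo) P (A `&` [set w | X w = n]).
Proof. exact: measure_nat_decomposition. Qed.

(** One product formula over the whole index type suffices, because the choice [U i = setT] recovers
    every subfamily. *)
Definition full_independent (I : finType) (X : I -> T -> nat) :=
  forall U : I -> set nat,
    P [set w | forall i, U i (X i w)] = \prod_i P [set w | U i (X i w)].

Lemma full_independentP (I : finType) (X : I -> T -> nat) :
  independent_rvs P X <-> full_independent X.
Proof.
split=> [H U|H J E HE].
  have := H finset.setT (fun i => [set w | U i (X i w)]).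
  rewrite (_ : \bigcap_(i in _) _ = [set w | forall i, U i (X i w)]); last first.
    by apply/seteqP; split => w Hw i => [|_]; apply: Hw; rewrite /= inE.
  move=> ->; first by apply: eq_bigl => i; rewrite inE.
  by move=> i _; exists (U i) => //; rewrite setTI.
have /choice[U HU] i : exists B : set nat,
    (i \in J -> E i = [set w | B (X i w)]) /\ (i \notin J -> B = setT).
  have [iJ|iJ] := boolP (i \in J); last by exists setT.
  by have [B _ <-] := HE i iJ; exists B; rewrite setTI.
rewrite (_ : \bigcap_(i in _) _ = [set w | forall i, U i (X i w)]); last first.
  apply/seteqP; split => w Hw i.
    have [iJ|iJ] := boolP (i \in J); last by rewrite (proj2 (HU i) iJ).
    by have := Hw i iJ; rewrite (proj1 (HU i) iJ).
  by move=> iJ; rewrite (proj1 (HU i) iJ); exact: Hw.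
rewrite H [RHS]big_mkcond; apply: eq_bigr => i _.
have [iJ|iJ] := boolP (i \in J); first by rewrite (proj1 (HU i) iJ).
by rewrite (proj2 (HU i) iJ) -(@probability_setT _ _ _ P); congr (P _).
Qed.

(** * Independence of sums over disjoint blocks *)

Section BlockSums.
Variables (I K : finType) (X : I -> T -> nat) (b : I -> K) (g : I -> nat -> nat).
Hypothesis mX : forall i, measurable_fun setT (X i).

Let block (D : {set I}) k w := (\sum_(i in D | b i == k) g i (X i w))%N.

(* D is the set of variables already absorbed into block sums.  Absorbing one
   more variable is done by splitting the event along its values. *)
Let block_indep D (U : K -> set nat) (V : I -> set nat) :=
  P [set w | (forall k, U k (block D k w)) /\
             (forall i, i \notin D -> V i (X i w))] =
  \prod_k P [set w | U k (block D k w)] *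
  \prod_(i | i \notin D) P [set w | V i (X i w)].

Let mblock D k : measurable_fun setT (block D k).
Proof. by apply: measurable_fun_sumn => i; exact: measurable_nat_comp. Qed.

Let mevent D U V : measurable [set w | (forall k, U k (block D k w)) /\
             (forall i, i \notin D -> V i (X i w))].
Proof.
apply: (measurableI [set w | forall k, U k (block D k w)]).
  by apply: measurable_all_fin => k; exact: measurable_nat_preimage.
apply: measurable_all_fin => i.
have [iD|iD] := boolP (i \in D).
  rewrite (_ : (fun _ => _) = setT)//; apply/funext => w; apply/propext.
  by split.
rewrite (_ : (fun _ => _) = [set w | V i (X i w)]).
  exact: measurable_nat_preimage.
by apply/funext => w; apply/propext; split=> [/(_ isT)|].
Qed.

Let block_indep0 : full_independent X -> forall U V, block_indep finset.set0 U V.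
Proof.
move=> HX U V; rewrite /block_indep.
have b0 k w : block finset.set0 k w = 0%N.
  by rewrite /block big1// => i; rewrite inE.
have [U0|] := pselect (forall k, U k 0%N).
  rewrite (_ : [set w | _ /\ _] = [set w | forall i, V i (X i w)]); last first.
    apply/seteqP; split => w /=; first by move=> [_ H] i; apply: H; rewrite inE.
    by move=> H; split=> [k|i _]; rewrite ?b0.
  rewrite HX [X in _ = X * _]big1 ?mul1e; last first.
    move=> k _; rewrite (_ : [set w | _] = setT) ?probability_setT//.
    by apply/seteqP; split=> // w _; rewrite /mkset b0.
  by apply: eq_bigl => i; rewrite inE.
move=> /existsNP[k Uk].
rewrite (bigD1 k)//= (_ : [set w | U k _] = set0); last first.
  by apply/seteqP; split=> // w; rewrite /mkset b0.
rewrite measure0 !mul0e (_ : [set w | _ /\ _] = set0) ?measure0//.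
by apply/seteqP; split=> // w [/(_ k)]; rewrite b0.
Qed.

(** On the slice [X i0 = n] the constraint on the block of [i0] becomes a shifted constraint on the
    smaller block sum, so the hypothesis for [D] applies slice by slice. The sum over [n] depends on
    the constraints only through [U k0]. *)
Let block_indepS (D : {set I}) i0 : i0 \notin D -> (forall U V, block_indep D U V) ->
  forall U V, block_indep (i0 |: D) U V.
Proof.
move=> i0D IH; set D' := i0 |: D; set k0 := b i0.
have blockS k w : block D' k w =
    (block D k w + (if k == k0 then g i0 (X i0 w) else 0))%N.
  rewrite /block /D' big_mkcondr [in RHS]big_mkcondr/= (big_setU1 _ i0D)/= addnC.
  by rewrite (eq_sym k).
have notinD' i : (i \notin D') = (i != i0) && (i \notin D).
  by rewrite /D' !inE negb_or.
pose phi (A : set nat) := \sum_(n <oo)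
  P [set w | A (block D k0 w + g i0 n)%N] * P [set w | X i0 w = n].
pose C U V := (\prod_(k | k != k0) P [set w | U k (block D k w)]) *
  \prod_(i | i \notin D') P [set w | V i (X i w)].
have main U V : P [set w | (forall k, U k (block D' k w)) /\
    (forall i, i \notin D' -> V i (X i w))] = C U V * phi (U k0).
  have CE : C U V = (fine (C U V))%:E.
    by rewrite fineK// fin_numM// prod_prob_fin// => i; exact: measurable_nat_preimage.
  rewrite (@prob_nat_decomposition (X i0))// CE -nneseriesZl; last first.
    by move=> n _; rewrite mule_ge0.
  apply: eq_eseriesr => n _; rewrite -CE.
  pose Un k := if k == k0 then [set m | U k (m + g i0 n)%N] else U k.
  pose Vn i := if i == i0 then [set n] else V i.
  rewrite (_ : _ `&` _ = [set w | (forall k, Un k (block D k w)) /\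
      (forall i, i \notin D -> Vn i (X i w))]); last first.
    apply/seteqP; split => w /=.
      move=> [[HU HV] Xn]; split=> [k|i iD].
        have := HU k; rewrite blockS /Un; case: eqP => _; last by rewrite addn0.
        by rewrite Xn.
      rewrite /Vn; case: eqP => [->//|/eqP ii0].
      by apply: HV; rewrite notinD' ii0.
    move=> [HU HV].
    have Xn : X i0 w = n by have := HV i0 i0D; rewrite /Vn eqxx.
    split=> //; split=> [k|i].
      have := HU k; rewrite blockS /Un; case: eqP => _; last by rewrite addn0.
      by rewrite Xn.
    rewrite notinD' => /andP[ii0 /HV].
    by rewrite /Vn (negPf ii0).
  rewrite IH (bigD1 k0)//= (bigD1 i0)//= /Un /Vn !eqxx /C.
  rewrite (eq_bigr (fun k => P [set w | U k (block D k w)])); last first.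
    by move=> k /negPf ->.
  rewrite (eq_bigl (fun i => i \notin D')); last first.
    by move=> i; rewrite notinD' andbC.
  rewrite [X in _ * (_ * X)](eq_bigr (fun i => P [set w | V i (X i w)])); last first.
    by move=> i; rewrite notinD' => /andP[/negPf ->].
  set a := P _; set p := \prod_(_ | _) _; set c := P _; set q := \prod_(_ | _) _.
  by rewrite muleACA [RHS]muleC.
move=> U V; rewrite /block_indep main.
(* The series [phi] is identified rather than computed: with trivial constraints off [k0] the factor
   [C] is 1, so [phi (U k0)] is the probability of the event on block [k0] alone. *)
pose U0 k := if k == k0 then U k else setT.
have := main U0 (fun=> setT).
rewrite (_ : [set w | _ /\ _] = [set w | U k0 (block D' k0 w)]); last first.
  apply/seteqP; split => w /=; first by move=> [/(_ k0)]; rewrite /U0 eqxx.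
  by move=> H; split=> // k; rewrite /U0; case: eqP => // ->.
have -> : C U0 (fun=> setT) = 1.
  rewrite /C !big1 ?mule1// => [i _|k /negPf kk0]; first exact: probability_setT.
  by rewrite /U0 kk0 probability_setT.
rewrite mul1e /U0 eqxx => <-.
rewrite [in RHS](bigD1 k0)//= muleC muleA; congr (_ * _ * _).
apply: eq_bigr => k /negPf kk0; congr (P _); apply/seteqP.
by split=> w; rewrite /mkset blockS kk0 addn0.
Qed.

Lemma full_independent_block_sums : full_independent X ->
  full_independent (fun k w => \sum_(i | b i == k) g i (X i w))%N.
Proof.
move=> HX.
have H D : forall U V, block_indep D U V.
  have [n Dn] : exists n, #|D| = n by exists #|D|.
  elim: n D Dn => [|n IH] D.
    by move=> /cards0_eq ->; exact: block_indep0.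
  move=> Dn; have /card_gt0P[i iD] : (0 < #|D|)%N by rewrite Dn.
  rewrite -(finset.setD1K iD); apply: block_indepS; first by rewrite !inE eqxx.
  by apply: IH; move: Dn; rewrite (cardsD1 i) iD => -[].
move=> U; have := H finset.setT U (fun=> setT).
rewrite /block_indep [X in _ * X]big1 ?mule1; last first.
  by move=> i _; exact: probability_setT.
have blockT k w : block finset.setT k w = (\sum_(i | b i == k) g i (X i w))%N.
  by apply: eq_bigl => i; rewrite inE.
under eq_bigr do under eq_set do rewrite blockT.
move=> <-; congr (P _); apply/seteqP; split => w /=.
  by move=> Uw; split=> // k; rewrite blockT.
by move=> [Uw _] k; rewrite -blockT.
Qed.

End BlockSums.

(** Constraints on the subfamily extend to all of [I] by [setT] outside the image of [h]. *)
Lemma full_independent_inj (I K : finType) (X : I -> T -> nat) (h : K -> I) :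
  injective h -> full_independent X -> full_independent (fun k => X (h k)).
Proof.
move=> hI HX U.
have [/existsP[k0 _]|/existsPn no] := boolP [exists k : K, true]; last first.
  rewrite big_pred0; last by move=> k; have := no k.
  rewrite (_ : [set w | _] = setT) ?probability_setT//.
  by apply/seteqP; split=> // w _ k; have := no k.
pose V i := if [pick k | h k == i] is Some k then U k else setT.
have Vh k : V (h k) = U k.
  rewrite /V; case: pickP => [k' /eqP /hI -> //|/(_ k)].
  by rewrite eqxx.
have Vout i : i \notin codom h -> V i = setT.
  rewrite /V; case: pickP => // k /eqP <-.
  by rewrite codom_f.
have := HX V.
rewrite (_ : [set w | _] = [set w | forall k, U k (X (h k) w)]); last first.
  apply/seteqP; split => w /= H k; first by rewrite -Vh.
  have [/codomP[k' ->]|/Vout -> //] := boolP (k \in codom h).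
  by rewrite Vh.
move=> ->; rewrite (bigID (mem (codom h)))/= [X in _ * X]big1 ?mule1; last first.
  by move=> i /Vout ->; exact: probability_setT.
rewrite (reindex_onto h (fun i => odflt k0 [pick k | h k == i])).
  apply: eq_big => k; last by rewrite Vh.
  rewrite codom_f/=; case: pickP => [k' /eqP/hI ->|/(_ k)]; first exact: eqxx.
  by rewrite eqxx.
move=> i /codomP[k ->]; case: pickP => [k' /eqP //|/(_ k)].
by rewrite eqxx.
Qed.

Lemma full_independent2 (I : finType) (X : I -> T -> nat) i j (U V : set nat) :
  full_independent X -> i != j ->
  P [set w | U (X i w) /\ V (X j w)] =
  P [set w | U (X i w)] * P [set w | V (X j w)].
Proof.
move=> HX ij; pose W k := if k == i then U else if k == j then V else setT.
have := HX W; rewrite (bigD1 i)//= (bigD1 j) 1?eq_sym//= big1 ?mule1; last first.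
  by move=> k /andP[/negPf ki /negPf kj]; rewrite /W ki kj; exact: probability_setT.
rewrite /W !eqxx eq_sym (negPf ij) => <-; congr (P _).
apply/seteqP; split => w /=.
  by move=> [Uw Vw] k; case: eqP => [->//|_]; case: eqP => [->//|].
move=> H; split; first by have := H i; rewrite eqxx.
by have := H j; rewrite eqxx eq_sym (negPf ij).
Qed.

End Independence.

(** * Expectations through tail probabilities *)

Section NatExpectation.
Context d (T : measurableType d) (R : realType) (P : probability T R).
Local Open Scope ereal_scope.

Lemma nneseries_nat (n : nat) (y : \bar R) : 0 <= y ->
  \sum_(a <oo) ((a < n)%N%:R)%:E * y = (n%:R)%:E * y.
Proof.
move=> y0; apply: lim_near_cst => //; near=> N.
rewrite -ge0_sume_distrl; last by move=> i _; rewrite lee_fin.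
congr (_ * _); rewrite sumEFin; congr (_%:E).
rewrite (@big_cat_nat _ _ _ n)//=; last by near: N; exact: nbhs_infty_ge.
rewrite [X in (_ + X)%R](_ : _ = 0%R) ?addr0; last first.
  by rewrite big_nat big1// => i /andP[ni _]; rewrite ltnNge ni.
rewrite big_nat (eq_bigr (fun=> 1%R)) => [|i /andP[_ ->]//].
by rewrite -big_nat big_const_nat subn0 iter_addr addr0.
Unshelve. all: by end_near. Qed.

Lemma measurable_natr_EFin (X : T -> nat) : measurable_fun setT X ->
  measurable_fun setT (fun w => ((X w)%:R : R)%:E).
Proof.
move=> mX; apply/measurable_EFinP.
exact: (@measurableT_comp _ _ _ _ _ _ (fun n : nat => n%:R : R)).
Qed.

(* X is the sum over a of the indicators of a < X. *)
Lemma integral_natr_mul (X : T -> nat) (Y : T -> \bar R) :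
  measurable_fun setT X -> measurable_fun setT Y -> (forall w, 0 <= Y w) ->
  \int[P]_w ((X w)%:R%:E * Y w) =
  \sum_(a <oo) \int[P]_w ((a < X w)%N%:R%:E * Y w).
Proof.
move=> mX mY Y0; rewrite -integral_nneseries//; last 2 first.
- move=> n; apply: emeasurable_funM => //; apply: measurable_natr_EFin.
  exact: (@measurable_nat_comp _ _ X (fun m => (n < m)%N : nat)).
- by move=> n w _; rewrite mule_ge0// lee_fin.
by apply: eq_integral => w _; rewrite nneseries_nat.
Qed.

Lemma integral_bool (A : pred T) : measurable [set w | A w] ->
  \int[P]_w ((A w)%:R%:E) = P [set w | A w].
Proof.
move=> mA; rewrite -(setIT [set w | A w]) -integral_indic//; apply: eq_integral => w _.
rewrite indicE; congr ((nat_of_bool _)%:R%:E).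
by apply/idP/idP => [Aw|/set_mem//]; exact/mem_set.
Qed.

Lemma integral_natr (X : T -> nat) : measurable_fun setT X ->
  \int[P]_w ((X w)%:R%:E) = \sum_(a <oo) P [set w | (a < X w)%N].
Proof.
move=> mX; transitivity (\int[P]_w ((X w)%:R%:E * cst 1 w)).
  by apply: eq_integral => w _; rewrite mule1.
rewrite integral_natr_mul//; apply: eq_eseriesr => n _.
under eq_integral do rewrite /= mule1.
exact/integral_bool/(@measurable_nat_preimage _ _ X (fun m => (n < m)%N)).
Qed.

Definition independent2 (X Y : T -> nat) := forall U V : set nat,
  P [set w | U (X w) /\ V (Y w)] = P [set w | U (X w)] * P [set w | V (Y w)].

(** Expanding both factors into indicators of [a < X] and [b < Y] reduces the claim to events; the
    finite mean of [Y] is the constant taken out of the sum over [a]. *)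
Lemma integral_independent2 (X Y : T -> nat) :
  measurable_fun setT X -> measurable_fun setT Y -> independent2 X Y ->
  \int[P]_w ((Y w)%:R%:E) \is a fin_num ->
  \int[P]_w ((X w)%:R%:E * (Y w)%:R%:E) =
  \int[P]_w ((X w)%:R%:E) * \int[P]_w ((Y w)%:R%:E).
Proof.
move=> mX mY XY Yfin; rewrite integral_natr_mul//; last exact: measurable_natr_EFin.
have msX (U : set nat) := measurable_nat_preimage U mX.
have msY (U : set nat) := measurable_nat_preimage U mY.
transitivity (\sum_(a <oo) \int[P]_w ((Y w)%:R%:E) * P [set w | (a < X w)%N]).
  apply: eq_eseriesr => a _; under eq_integral do rewrite muleC.
  rewrite integral_natr_mul//; last first.
    apply: measurable_natr_EFin.
    exact: (@measurable_nat_comp _ _ X (fun m => (a < m)%N : nat)).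
  rewrite integral_natr// muleC -(fineK (prob_fin P (msX (fun m => (a < m)%N)))).
  rewrite -nneseriesZl//; apply: eq_eseriesr => b _.
  rewrite fineK; last exact/prob_fin/(msX (fun m => (a < m)%N)).
  rewrite -(XY (fun m => (a < m)%N) (fun m => (b < m)%N)).
  transitivity (\int[P]_w (((a < X w) && (b < Y w))%N%:R%:E)).
    by apply: eq_integral => w _; rewrite -EFinM -natrM mulnb andbC.
  have abE : [set w | (a < X w) && (b < Y w)]%N =
             [set w | (a < X w)%N] `&` [set w | (b < Y w)%N].
    by apply/seteqP; split => w /= => [/andP[]|[-> ->]].
  rewrite (@integral_bool (fun w => (a < X w) && (b < Y w))%N) ?abE//; apply: measurableI.
  - exact: (msX (fun m => (a < m)%N)).
  - exact: (msY (fun m => (b < m)%N)).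
rewrite -(fineK Yfin) nneseriesZl// fineK// muleC -integral_natr//.
Qed.

(** Such an [f (X w)] takes finitely many values, so its mean is a finite combination of the
    probabilities that the rates control, plus one tail term. It serves for truncations and for
    products of two of them. *)
Lemma integral_natr_finite (X : T -> nat) (f : nat -> nat) k :
  measurable_fun setT X -> f 0%N = 0%N -> (forall n, (k < n)%N -> f n = f k.+1) ->
  \int[P]_w ((f (X w))%:R%:E) =
  \sum_(1 <= j < k.+1) ((f j)%:R%:E * P [set w | X w = j]) +
  (f k.+1)%:R%:E * P [set w | (k < X w)%N].
Proof.
move=> mX f0 fk.
have msX (U : set nat) := measurable_nat_preimage U mX.
have mb (p : pred nat) : measurable_fun setT (fun w => (p (X w))%:R%:E : \bar R).
  apply: measurable_natr_EFin.
  exact: (@measurable_nat_comp _ _ X (fun m => p m : nat)).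
transitivity (\int[P]_w (\sum_(1 <= j < k.+1) ((f j)%:R%:E * (X w == j)%:R%:E) +
   (f k.+1)%:R%:E * (k < X w)%N%:R%:E)).
  apply: eq_integral => w _; rewrite -EFinM.
  under eq_bigr do rewrite -EFinM -natrM.
  rewrite sumEFin -natr_sum -natrM -EFinD -natrD; congr (_%:R%:E).
  have [kX|Xk] := ltnP k (X w).
    rewrite fk// muln1 big_nat big1// => j /andP[_ jk].
    by rewrite gtn_eqF ?muln0// (leq_ltn_trans _ kX).
  rewrite muln0 addn0; have [->|X0] := posnP (X w).
    by rewrite f0 big_nat big1// => j /andP[j0 _]; rewrite ltn_eqF ?muln0.
  rewrite (bigD1_seq (X w)) ?iota_uniq//=; last by rewrite mem_index_iota X0.
  by rewrite eqxx muln1 big1 ?addn0// => j /negPf; rewrite eq_sym => ->; rewrite muln0.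
rewrite ge0_integralD//; last 3 first.
- by move=> w _; apply: sume_ge0 => j _; rewrite mule_ge0// lee_fin.
- apply: emeasurable_sum => j; apply: emeasurable_funM => //.
  exact: (mb (fun n => n == j)).
- by apply: emeasurable_funM => //; exact: (mb (fun n => k < n)%N).
rewrite ge0_integral_sum//; last first.
- by move=> j; apply: emeasurable_funM => //; exact: (mb (fun n => n == j)).
rewrite ge0_integralZl//.
rewrite (@integral_bool (fun w => k < X w)%N)//; last exact: (msX (fun m => (k < m)%N)).
congr (_ + _); apply: eq_bigr => j _.
rewrite ge0_integralZl//; last exact: (mb (fun n => n == j)).
have jE : [set w | X w == j] = [set w | X w = j].
  by apply/seteqP; split => w /= /eqP.
rewrite (@integral_bool (fun w => X w == j)) jE//; exact: (msX [set j]).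
Qed.

End NatExpectation.

(** * The Poisson limit theorem *)

Lemma cvg_near_eq {U : topologicalType} (u v : nat -> U) (l : U) :
  u n @[n --> \oo] --> l -> (\forall n \near \oo, u n = v n) ->
  v n @[n --> \oo] --> l.
Proof. by move=> ul uv; apply: (cvg_trans _ ul); exact: near_eq_cvg. Qed.

Section PoissonLimit.
Context {R : realType}.
Implicit Types (x : R) (p : nat -> R).

(* Unlike poisson_pmf, this is the Dirac mass at 0 when x = 0. *)
Definition poisson_weight x (a : nat) : R := x ^+ a / a`!%:R * expR (- x).

Lemma cvg_prod_fin (I : finType) (c : pred I) (F : I -> nat -> R) (l : I -> R) :
  (forall i, c i -> F i n @[n --> \oo] --> l i) ->
  \prod_(i | c i) F i n @[n --> \oo] --> \prod_(i | c i) l i.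
Proof.
by move=> H; apply: cvg_big => //; exact: mul_continuous.
Qed.

Lemma cvg_sum_fin (I : Type) (r : seq I) (c : pred I) (F : I -> nat -> R) (l : I -> R) :
  (forall i, c i -> F i n @[n --> \oo] --> l i) ->
  \sum_(i <- r | c i) F i n @[n --> \oo] --> \sum_(i <- r | c i) l i.
Proof.
by move=> H; apply: cvg_big => //; exact: add_continuous.
Qed.

Lemma cvgX_seq (u : nat -> R) (l : R) a :
  u n @[n --> \oo] --> l -> u n ^+ a @[n --> \oo] --> l ^+ a.
Proof.
move=> H; rewrite -[in X in _ --> X](card_ord a) -prodr_const.
apply: cvg_near_eq; first exact: (@cvg_prod_fin _ _ _ _ (fun (i : 'I_a) _ => H)).
by apply: nearW => n; rewrite prodr_const card_ord.
Qed.

Lemma cvg_inv_exp2 : ((2 ^ n)%:R^-1 : R) @[n --> \oo] --> (0 : R).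
Proof.
have := @cvg_expr R (2^-1); rewrite ger0_norm ?invr_ge0// => H.
under eq_cvg do rewrite natrX -exprVn.
by apply: H; rewrite invf_lt1// ltr1n.
Qed.

Section Limit.
Variables (p : nat -> R) (x : R).
Hypothesis p01 : forall n, 0 <= p n <= 1.
Hypothesis px : (2 ^ n)%:R * p n @[n --> \oo] --> x.

Lemma thin_cvg0 : p n @[n --> \oo] --> (0 : R).
Proof.
rewrite -(mul0r x); apply: cvg_near_eq (cvgM cvg_inv_exp2 px) _.
apply: nearW => n /=.
by rewrite mulrA mulVf ?mul1r// natr_exp2_neq0.
Qed.

Lemma thin_lt1 : \forall n \near \oo, p n < 1.
Proof. by apply: (@cvgr_lt _ _ \oo _ p 0) => //; exact: thin_cvg0. Qed.

(** A squeeze by [1 + y <= expR y]: taken at [- p n] it gives the upper bound, and at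
    [p n / (1 - p n)], after inversion, the lower one. *)
Lemma cvg_expr_thin : (1 - p n) ^+ (2 ^ n) @[n --> \oo] --> expR (- x).
Proof.
have p0 := thin_cvg0.
have h1 : expR (- ((2 ^ n)%:R * p n)) @[n --> \oo] --> expR (- x).
  by apply: continuous_cvg; [exact: continuous_expR|exact: cvgN].
have h2 : expR (- ((2 ^ n)%:R * p n) / (1 - p n)) @[n --> \oo] --> expR (- x).
  apply: continuous_cvg; first exact: continuous_expR.
  rewrite -[X in _ --> X]mulr1 -[X in _ * X]invr1; apply: cvgM; first exact: cvgN.
  apply: cvgV; first exact: oner_neq0.
  by rewrite -[X in _ --> X]subr0; apply: cvgB => //; exact: cvg_cst.
apply: squeeze_cvgr h2 h1; near=> n.
have pn1 : p n < 1 by near: n; exact: thin_lt1.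
have q0 : 0 < 1 - p n by rewrite subr_gt0.
apply/andP; split; last first.
  rewrite -mulrN expRM_natl lerXn2r ?nnegrE ?expR_ge0 ?(ltW q0)//.
  by have := expR_ge1Dx (- p n).
rewrite -mulrN -mulrA expRM_natl lerXn2r ?nnegrE ?expR_ge0 ?(ltW q0)//.
rewrite mulNr expRN invf_ple ?posrE ?expR_gt0//.
apply: le_trans (expR_ge1Dx _).
by rewrite le_eqVlt; apply/orP; left; apply/eqP; field; exact: lt0r_neq0.
Unshelve. all: by end_near. Qed.

(** For [a <= 2 ^ n] the weight is the product of the [a] factors [(2 ^ n - i) * p n], divided by
    the factorial of [a], times [(1 - p n) ^+ (2 ^ n)], over [(1 - p n) ^+ a]. Each of the [a]
    factors tends to [x], the power to [expR (- x)], and the last denominator to 1. *)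
Lemma binomial_poisson_limit a :
  'C(2 ^ n, a)%:R * p n ^+ a * (1 - p n) ^+ (2 ^ n - a) @[n --> \oo] -->
  poisson_weight x a.
Proof.
have p0 := thin_cvg0.
have H1 : \prod_(i < a) (((2 ^ n)%:R - i%:R) * p n) @[n --> \oo] --> x ^+ a.
  rewrite -[in X in _ --> X](card_ord a) -prodr_const; apply: cvg_prod_fin => i _.
  rewrite -(subr0 x) -(mulr0 i%:R).
  apply: cvg_near_eq; first exact: (cvgB px (cvgM (cvg_cst (i%:R : R)) p0)).
  by apply: nearW => n /=; rewrite mulrBl.
have H2 : (1 - p n) ^- a @[n --> \oo] --> (1 : R).
  have : (1 - p n) ^+ a @[n --> \oo] --> (1 : R).
    rewrite -[X in _ --> X](expr1n _ a).
    apply: cvgX_seq.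
    by rewrite -[X in _ --> X]subr0; apply: cvgB => //; exact: cvg_cst.
  by move=> /(cvgV (oner_neq0 _)); rewrite invr1.
rewrite /poisson_weight -[X in _ --> X]mulr1.
apply: cvg_near_eq.
  exact: (cvgM (cvgM (cvgM H1 (cvg_cst (a`!%:R^-1 : R))) cvg_expr_thin) H2).
near=> n.
have pn1 : p n < 1 by near: n; exact: thin_lt1.
have q0 : (1 - p n) != 0 by rewrite gt_eqF// subr_gt0.
have na : (a <= 2 ^ n)%N.
  apply: (@leq_trans n); last by rewrite ltnW// ltn_expl.
  by near: n; exact: nbhs_infty_ge.
rewrite /= -[LHS]mulrA -exprB// ?unitfE//; congr (_ * _).
rewrite big_split/= prodr_const card_ord mulrAC; congr (_ * _).
rewrite (eq_bigr (fun i : 'I_a => (2 ^ n - i)%:R)) => [|i _]; last first.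
  by rewrite natrB// (leq_trans _ na)// ltnW.
rewrite -natr_prod -ffact_prod -bin_ffact natrM mulfK// pnatr_eq0 -lt0n fact_gt0.
Unshelve. all: by end_near. Qed.

End Limit.
End PoissonLimit.

Section ProbabilityLimits.
Context d (T : measurableType d) (R : realType) (P : probability T R).
Local Open Scope ereal_scope.

(** Eventual agreement at each outcome is pointwise convergence of indicators, which are dominated
    by 1. *)
Lemma prob_cvg (E : nat -> set T) (E0 : set T) :
  (forall n, measurable (E n)) -> measurable E0 ->
  (forall w, \forall n \near \oo, E n w <-> E0 w) ->
  P (E n) @[n --> \oo] --> P E0.
Proof.
move=> mE mE0 HE.
have indE (A : set T) : measurable A -> P A = \int[P]_w (\1_A w)%:E.
  by move=> mA; rewrite integral_indic// setIT.
rewrite indE//; under eq_cvg do rewrite indE//.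
have [|||||_ _ //] := @dominated_convergence _ _ _ P setT measurableT
  (fun n w => (\1_(E n) w)%:E) (fun w => (\1_E0 w)%:E) (cst 1).
- by move=> n; exact/measurable_EFinP.
- exact/measurable_EFinP.
- apply: aeW => w _; apply: (@cvg_near_eq _ (fun=> (\1_E0 w)%:E)).
    exact: cvg_cst.
  near=> n; rewrite !indicE; congr ((nat_of_bool _)%:R%:E).
  have EE : E n w <-> E0 w by near: n; exact: HE.
  by apply/idP/idP => /set_mem/EE/mem_set.
- exact: finite_measure_integrable_cst.
- by apply: aeW => w n _; rewrite gee0_abs ?lee_fin// indicE.
Unshelve. all: by end_near. Qed.

Lemma prob_disjoint_union (K : finType) (c : pred K) (F : K -> set T) :
  (forall k, measurable (F k)) ->
  (forall k l w, F k w -> F l w -> k = l) ->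
  P [set w | exists2 k, c k & F k w] = \sum_(k | c k) P (F k).
Proof.
move=> mF tF.
rewrite (_ : [set w | _] = \bigcup_(k in [set k | c k]) F k)//.
rewrite measure_fin_bigcup//; last 2 first.
- exact: finite_finset.
- by move=> i j _ _ [w [iw jw]]; exact: tF iw jw.
rewrite (fsbigE (enum c))//; last 3 first.
- exact: enum_uniq.
- by move=> k /=; rewrite mem_enum.
- by move=> k /= ck; rewrite mem_enum -topredE/= ck.
rewrite -[RHS]big_enum/= [LHS]big_seq_cond [RHS]big_seq; apply: eq_bigl => k.
rewrite mem_enum; have [ck|//] := boolP (k \in c).
by apply/mem_set; exact: ck.
Qed.

End ProbabilityLimits.

(** * Jump counts along dyadic grids *)

(** Both sides are countably additive in [U], hence fixed by their point masses. The measure [mu] is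
    arbitrary so that it can also be a conditional probability. *)
Lemma eq_nat_measures d (T : measurableType d) (R : realType)
    (mu : {measure set T -> \bar R}) (nu : {measure set nat -> \bar R}) (X : T -> nat) :
  measurable_fun setT X -> (forall n, mu [set w | X w = n] = nu [set n]) ->
  forall U : set nat, mu [set w | U (X w)] = nu U.
Proof.
move=> mX H U.
rewrite (@measure_nat_decomposition _ _ _ _ X)//; last exact: measurable_nat_preimage.
rewrite (@measure_nat_decomposition _ _ _ nu id U)//.
apply: eq_eseriesr => n _; have [Un|nUn] := pselect (U n).
  rewrite (_ : _ `&` _ = [set w | X w = n]); last first.
    by apply/seteqP; split => w /= => [[]//|Xn]; rewrite Xn.
  by rewrite H; congr (nu _); apply/seteqP; split => m /= => [->|[]//]; split.
rewrite (_ : _ `&` _ = set0); last first.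
  by apply/seteqP; split => w //= [] + Xn; rewrite Xn.
rewrite measure0 (_ : _ `&` _ = set0) ?measure0//.
by apply/seteqP; split => m //= [] + Xn; rewrite Xn.
Qed.

Lemma poisson_prob_set1 (R : realType) (x : R) n : 0 <= x ->
  poisson_prob x 0 [set n] = (poisson_weight x n)%:E.
Proof.
rewrite le_eqVlt => /predU1P[<-|x0].
  (* At mean 0 the library switches to a Dirac mass, which [poisson_weight] reproduces because
     [0 ^+ 0 = 1]. *)
  rewrite /poisson_prob ltxx diracE /poisson_weight oppr0 expR0 mulr1 expr0n.
  case: n => [|n]; first by rewrite mem_set// fact0 invr1 mulr1.
  by rewrite memNset//= mul0r.
rewrite /poisson_prob x0 esum_set1; last by rewrite lee_fin poisson_pmf_ge0.
by rewrite /poisson_pmf x0.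
Qed.

Section JumpMeasurability.
Context d (T : measurableType d) (R : realType) (Y : R -> T -> nat).
Hypothesis mY : forall u : R, 0 <= u -> measurable_fun setT (Y u).

Lemma measurable_increment (u v : R) : 0 <= u -> 0 <= v ->
  measurable_fun setT (fun w => Y v w - Y u w)%N.
Proof. by move=> u0 v0; apply: measurable_fun_subn; exact: mY. Qed.

Lemma measurable_dyadic_sum c (s t : R) n : 0 <= s -> s <= t ->
  measurable_fun setT (fun w => dyadic_sum c (Y ^~ w) s t n).
Proof.
move=> s0 st; apply: measurable_fun_sumn => j.
apply: (@measurable_nat_comp _ _ (fun w => (_ - _)%N) (minn^~ c)).
by apply: measurable_increment; rewrite (le_trans s0) ?grid_ge.
Qed.

Hypothesis pathY : forall w, counting_path (Y ^~ w).

(** The event is the limit inferior of the same events for dyadic sums. The ambient sigma-algebra is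
    arbitrary, so it may be the one generated by the process itself. *)
Lemma measurable_jumpn (s t : R) : 0 <= s -> s <= t ->
  measurable_fun setT (fun w => jumpn (Y ^~ w) s t).
Proof.
move=> s0 st _ U _; rewrite setTI.
rewrite (_ : _ @^-1` _ = \bigcup_N \bigcap_(n in [set n | (N <= n)%N])
   [set w | U (dyadic_sum 1 (Y ^~ w) s t n)]); last first.
  apply/seteqP; split => w /=.
    move=> Uw; have [N _ HN] := dyadic_sum_cvg (pathY w) s0 st.
    by exists N => // n Nn /=; rewrite HN.
  move=> [N _ HN]; have [N' _ HN'] := dyadic_sum_cvg (pathY w) s0 st.
  rewrite -(HN' (maxn N N')) /=; last exact: leq_maxr.
  by apply: HN => /=; exact: leq_maxl.
apply: bigcup_measurable => N _; apply: bigcap_measurableType => n _.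
by apply: measurable_nat_preimage; exact: measurable_dyadic_sum.
Qed.

End JumpMeasurability.

Section JumpCount.
Context d (T : measurableType d) (R : realType) (P : probability T R).
Variable (Y : R -> T -> nat).
Hypothesis cY : counting_process Y.

Lemma counting_process_path w : counting_path (Y ^~ w).
Proof. by case: cY => _ H1 H2; split=> [s t|t]; [exact: H1|exact: H2]. Qed.

Lemma counting_process_measurable u : 0 <= u -> measurable_fun setT (Y u).
Proof. by case: cY => H _ _; exact: H. Qed.

Let pathY := counting_process_path.
Let mY := counting_process_measurable.

Lemma jump_countB s t w : 0 <= s -> s <= t ->
  (jump_count Y t w - jump_count Y s w)%N = jumpn (Y ^~ w) s t.
Proof.
move=> s0 st; rewrite [jump_count Y t w](_ : _ = jumpn (Y ^~ w) 0 t)//.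
by rewrite -(jumpnD (pathY w) (lexx 0) s0 st) addKn.
Qed.

Lemma counting_process_jump_count : counting_process (jump_count Y).
Proof.
split=> [t t0|w s t|w t].
- exact: measurable_jumpn.
- exact: (proj1 (counting_path_jumpn (pathY w))).
- exact: (proj2 (counting_path_jumpn (pathY w))).
Qed.

Lemma jump_count0 w : jump_count Y 0 w = 0%N.
Proof.
rewrite -[LHS](jumpnD (pathY w) (lexx 0) (lexx 0) (lexx 0)).
by apply/eqP; rewrite -leqn0 leqNgt addn_gt0 orbb jumpn_gt0// ltnn.
Qed.

Hypothesis iY : independent_increments P Y.

Lemma grid_independent s t n : 0 <= s -> s <= t ->
  full_independent P (fun (j : 'I_(2 ^ n)) w =>
    (Y (grid s t n j.+1) w - Y (grid s t n j) w)%N).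
Proof.
move=> s0 st; apply/full_independentP.
apply: (iY (n := (2 ^ n)%N) (t := grid s t n)); first by rewrite grid0.
by move=> j _; exact: grid_le.
Qed.

(** The event splits according to the set [D] of cells on which the process increases; by
    independence all [D] with [a] elements contribute equally. *)
Lemma dyadic_sum_law s t n (p : R) a : 0 <= s -> s <= t ->
  (forall j, (j < 2 ^ n)%N ->
    P [set w | (0 < Y (grid s t n j.+1) w - Y (grid s t n j) w)%N] = p%:E) ->
  P [set w | dyadic_sum 1 (Y ^~ w) s t n = a] =
  ('C(2 ^ n, a)%:R * p ^+ a * (1 - p) ^+ (2 ^ n - a))%:E.
Proof.
move=> s0 st Hp.
pose inc (j : 'I_(2 ^ n)) w := (Y (grid s t n j.+1) w - Y (grid s t n j) w)%N.
have minc j : measurable_fun setT (inc j).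
  by apply: measurable_increment; rewrite // (le_trans s0) ?grid_ge.
pose V (D : {set 'I_(2 ^ n)}) j := [set m : nat | (0 < m)%N = (j \in D)].
pose F D := [set w | forall j, V D j (inc j w)].
have -> : [set w | dyadic_sum 1 (Y ^~ w) s t n = a] =
    [set w | exists2 D : {set 'I_(2 ^ n)}, #|D| == a & F D w].
  have sumE w : dyadic_sum 1 (Y ^~ w) s t n = #|[set j | (0 < inc j w)%N]%SET|.
    rewrite -sum1dep_card big_mkcond/=; apply: eq_bigr => j _.
    by rewrite -/(inc j w); case: (inc j w).
  apply/seteqP; split => w; rewrite /mkset sumE; last first.
    by move=> [D /eqP <- HD]; apply: eq_card => j; rewrite inE; exact: HD.
  move=> Ha.
  by exists [set j | (0 < inc j w)%N]%SET; [exact/eqP|move=> j; rewrite /V/= inE].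
rewrite prob_disjoint_union; last 2 first.
- by move=> D; apply: measurable_all_fin => j; exact: measurable_nat_preimage.
- by move=> D D' w FD FD'; apply/setP => j; rewrite -FD -FD'.
have PF D : P (F D) = (p ^+ #|D| * (1 - p) ^+ (2 ^ n - #|D|))%:E.
  rewrite (grid_independent s0 st (V D)).
  rewrite (eq_bigr (fun j => (if j \in D then p else 1 - p)%:E)) => [|j _].
    rewrite -(big_morph EFin EFinM erefl) (bigID (mem D))/=.
    rewrite (eq_bigr (fun=> p)) => [|j ->//].
    rewrite [in X in _ * X](eq_bigr (fun=> 1 - p)) => [|j /negPf ->//].
    by rewrite !prodr_const -[X in (X - _)%N]card_ord -(cardC (mem D)) addKn.
  have := Hp j (ltn_ord j); rewrite -/(inc j) /V/= => Hj.
  case: ifP => jD; first by rewrite -Hj; congr (P _).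
  have -> : [set w | (0 < inc j w)%N = false] = ~` [set w | (0 < inc j w)%N].
    by apply/seteqP; split => w /=; [move=> ->|move/negP/negbTE].
  rewrite probability_setC ?Hj//.
  exact: (measurable_nat_preimage (fun m => (0 < m)%N)).
rewrite (eq_bigr (fun=> (p ^+ a * (1 - p) ^+ (2 ^ n - a))%:E)) => [|D /eqP <-//].
rewrite sumEFin sumr_const -cardsE card_draws card_ord.
by rewrite -[X in X%:E = _]mulr_natl mulrA.
Qed.

(** The input of the Poisson limit: one common probability of moving for the cells of a level, and
    an expected number of moving cells that tends to [L * (t - s)]. It ignores jump sizes, which is
    why it survives independent sums. *)
Definition has_jump_rate (L : R) := forall s t, 0 <= s -> s <= t ->
  exists2 p : nat -> R,
    forall n j, (j < 2 ^ n)%N ->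
      P [set w | (0 < Y (grid s t n j.+1) w - Y (grid s t n j) w)%N] = (p n)%:E &
    (2 ^ n)%:R * p n @[n --> \oo] --> L * (t - s).

(** The probabilities for dyadic sums have two limits, one from exactness on each path and one from
    the binomial law; they must coincide. *)
Lemma jumpn_law L s t a : has_jump_rate L -> 0 <= s -> s <= t ->
  P [set w | jumpn (Y ^~ w) s t = a] = (poisson_weight (L * (t - s)) a)%:E.
Proof.
move=> HL s0 st; have [p Hp pL] := HL s t s0 st.
have p01 n : 0 <= p n <= 1.
  have mE : measurable [set w | (0 < Y (grid s t n 1) w - Y (grid s t n 0) w)%N].
    apply: (@measurable_nat_preimage _ _ (fun w => _ - _)%N (fun m => (0 < m)%N)).
    by apply: measurable_increment; rewrite // (le_trans s0) ?grid_ge.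
  have p0 := Hp n 0%N (expn_gt0 _ _).
  by rewrite -!lee_fin -p0 measure_ge0 probability_le1.
have H1 : P [set w | dyadic_sum 1 (Y ^~ w) s t n = a] @[n --> \oo] -->
    P [set w | jumpn (Y ^~ w) s t = a].
  apply: prob_cvg => [n||w].
  - by apply: (measurable_nat_preimage [set a]); exact: measurable_dyadic_sum.
  - by apply: (measurable_nat_preimage [set a]); exact: measurable_jumpn.
  - by have := dyadic_sum_cvg (pathY w) s0 st; apply: filterS => n /= ->.
apply: (cvg_unique _ H1) => //.
apply: cvg_EFin; first by apply: nearW => n; rewrite (dyadic_sum_law _ s0 st (Hp n)).
under eq_cvg do rewrite /= (dyadic_sum_law _ s0 st (Hp _)).
exact: binomial_poisson_limit.
Qed.

Lemma jump_count_law L s t U : 0 <= L -> has_jump_rate L -> 0 <= s -> s <= t ->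
  P [set w | U (jump_count Y t w - jump_count Y s w)%N] =
  poisson_prob (L * (t - s)) 0 U.
Proof.
move=> L0 HL s0 st.
under eq_set do rewrite jump_countB//.
apply: (eq_nat_measures (mu := P) (nu := poisson_prob (L * (t - s)) 0)).
  exact: measurable_jumpn.
have Lst : 0 <= L * (t - s) by rewrite mulr_ge0// subr_ge0.
by move=> n; exact: etrans (jumpn_law n HL s0 st) (esym (poisson_prob_set1 n Lst)).
Qed.

End JumpCount.

Lemma nondecreasing_times_ge0 (R : realType) (n : nat) (t : nat -> R) :
  0 <= t 0 -> (forall j, (j < n)%N -> t j <= t j.+1) ->
  forall j, (j <= n)%N -> 0 <= t j.
Proof.
move=> t0 tS; elim=> // j IH jn.
by apply: le_trans (tS j jn); apply: IH; exact: ltnW.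
Qed.

Section IndependentJumpIncrements.
Context d (T : measurableType d) (R : realType) (P : probability T R).
Variable (Y : R -> T -> nat).
Hypotheses (cY : counting_process Y) (iY : independent_increments P Y).

Let pathY := counting_process_path cY.
Let mY := counting_process_measurable cY.

Variables (n : nat) (t : nat -> R).
Hypotheses (t0 : 0 <= t 0) (tS : forall j, (j < n)%N -> t j <= t j.+1).

Let t_ge0 j : (j <= n)%N -> 0 <= t j.
Proof. exact: nondecreasing_times_ge0. Qed.

Section Refinement.
Variable m : nat.
Let K := (2 ^ m)%N.
Let tau l := grid (t (l %/ K)) (t (l %/ K).+1) m (l %% K).

Let K0 : (0 < K)%N. Proof. by rewrite expn_gt0. Qed.

Let tauS l : tau l.+1 = grid (t (l %/ K)) (t (l %/ K).+1) m (l %% K).+1.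
Proof.
have lK := ltn_pmod l K0; have lE : l.+1 = (l %/ K * K + (l %% K).+1)%N.
  by rewrite addnS -divn_eq.
have [lt|] := ltnP (l %% K).+1 K.
  have dE : (l.+1 %/ K = l %/ K)%N by rewrite lE divnMDl// (divn_small lt) addn0.
  have mE : (l.+1 %% K = (l %% K).+1)%N by rewrite {1}lE modnMDl modn_small.
  by rewrite /tau dE mE.
(* Last cell of an interval: the next point of [tau] opens the following grid and coincides with the
   end of the current one. *)
move=> le; have {lK le} lK : (l %% K).+1 = K by apply/eqP; rewrite eqn_leq lK le.
have lE' : l.+1 = ((l %/ K).+1 * K)%N by rewrite mulSnr {1}lE lK.
by rewrite /tau lK {1 2 3}lE' mulnK// modnMl grid0 gridE.
Qed.

(** Independence of increments concerns a single nondecreasing sequence of times, so the grids of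
    all intervals are strung into [tau], cell [r] of interval [p] sitting at [l = p * K + r]. *)
Lemma refined_increments_independent : full_independent P
  (fun (p : 'I_n * 'I_K) w => (Y (grid (t p.1) (t p.1.+1) m p.2.+1) w -
                                 Y (grid (t p.1) (t p.1.+1) m p.2) w)%N).
Proof.
have H : full_independent P
    (fun (l : 'I_(n * K)) w => (Y (tau l.+1) w - Y (tau l) w)%N).
  apply/full_independentP; apply: (iY (n := (n * K)%N) (t := tau)).
    by rewrite /tau div0n mod0n grid0.
  move=> l lnK; rewrite tauS; apply: grid_le => //.
  by apply: tS; rewrite ltn_divLR.
have ltnK (p : 'I_n * 'I_K) : (p.1 * K + p.2 < n * K)%N.
  apply: (@leq_trans (p.1.+1 * K)%N); first by rewrite mulSnr ltn_add2l.
  by rewrite leq_pmul2r.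
have inj : injective (fun p => Ordinal (ltnK p)).
  move=> [a b] [a' b'] [] /= H'.
  have := congr1 (modn^~ K) H'; have := congr1 (divn^~ K) H'.
  rewrite /= !divnMDl// !divn_small// !addn0 !modnMDl !modn_small//.
  by move=> aa bb; congr (_, _); exact: val_inj.
have := full_independent_inj inj H; congr (full_independent P _).
apply/funext => -[a b]; apply/funext => w /=.
by rewrite tauS /tau divnMDl// modnMDl divn_small// modn_small// addn0.
Qed.

Lemma dyadic_sums_independent c : full_independent P
  (fun (j : 'I_n) w => dyadic_sum c (Y ^~ w) (t j) (t j.+1) m).
Proof.
pose inc (p : 'I_n * 'I_K) w := (Y (grid (t p.1) (t p.1.+1) m p.2.+1) w -
                                 Y (grid (t p.1) (t p.1.+1) m p.2) w)%N.
have minc p : measurable_fun setT (inc p).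
  have g0 i : 0 <= grid (t p.1) (t p.1.+1) m i.
    by rewrite (le_trans (t_ge0 (ltnW (ltn_ord p.1))))// grid_ge// tS.
  by apply: measurable_increment.
have := full_independent_block_sums fst (fun _ => minn^~ c) minc
  refined_increments_independent.
congr (full_independent P _).
apply/funext => j; apply/funext => w.
rewrite (eq_bigl (fun p : 'I_n * 'I_K => (p.1 == j) && xpredT p.2)); last first.
  by move=> p; rewrite andbT.
rewrite -(pair_big (pred1 j) xpredT (fun a b => minn (inc (a, b) w) c))/=.
by rewrite big_pred1_eq.
Qed.

End Refinement.

(** The product formula holds for dyadic sums at every level, and both sides converge: each event,
    and the intersection of all, eventually agrees with the one for jump counts. *)
Lemma jumpn_independent :
  full_independent P (fun (j : 'I_n) w => jumpn (Y ^~ w) (t j) (t j.+1)).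
Proof.
move=> U.
have tj (j : 'I_n) : 0 <= t j /\ t j <= t j.+1.
  by split; [exact/t_ge0/ltnW|exact: tS].
have mD (j : 'I_n) m : measurable_fun setT
    (fun w => dyadic_sum 1 (Y ^~ w) (t j) (t j.+1) m).
  by have [? ?] := tj j; exact: measurable_dyadic_sum.
have mJ (j : 'I_n) : measurable_fun setT (fun w => jumpn (Y ^~ w) (t j) (t j.+1)).
  by have [? ?] := tj j; exact: measurable_jumpn.
pose F (j : 'I_n) m := [set w | U j (dyadic_sum 1 (Y ^~ w) (t j) (t j.+1) m)].
pose F0 (j : 'I_n) := [set w | U j (jumpn (Y ^~ w) (t j) (t j.+1))].
have mF j m : measurable (F j m) by exact: measurable_nat_preimage.
have mF0 j : measurable (F0 j) by exact: measurable_nat_preimage.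
have FF0 j w : \forall m \near \oo, F j m w <-> F0 j w.
  have [h1 h2] := tj j.
  by have := dyadic_sum_cvg (pathY w) h1 h2; apply: filterS => m; rewrite /F /F0 /= => ->.
have H1 : P [set w | forall j, F j m w] @[m --> \oo] --> P [set w | forall j, F0 j w].
  apply: prob_cvg => [m||w]; [exact: measurable_all_fin|exact: measurable_all_fin|].
  have : \forall m \near \oo, forall j, F j m w <-> F0 j w by exact: filter_forall.
  by apply: filterS => m H; split=> HF j; exact/H.
apply: (cvg_unique _ H1) => //.
have fineF j m : P (F j m) = (fine (P (F j m)))%:E by rewrite fineK ?prob_fin.
have fineF0 j : P (F0 j) = (fine (P (F0 j)))%:E by rewrite fineK ?prob_fin.
rewrite (eq_bigr _ (fun j _ => fineF0 j)) -(big_morph EFin EFinM erefl).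
apply: (@cvg_near_eq _ (fun m => (\prod_(j < n) fine (P (F j m)))%:E)).
  apply: cvg_EFin; first exact: nearW.
  apply: cvg_prod_fin => j _.
  have : P (F j m) @[m --> \oo] --> (fine (P (F0 j)))%:E.
    by rewrite -fineF0; apply: prob_cvg => // w; exact: FF0.
  by move=> /fine_cvgP[].
apply: nearW => m; rewrite (dyadic_sums_independent m 1 U).
by rewrite (eq_bigr _ (fun j _ => fineF j m)) -(big_morph EFin EFinM erefl).
Qed.

End IndependentJumpIncrements.

Section JumpCountProcess.
Context d (T : measurableType d) (R : realType) (P : probability T R).
Variable (Y : R -> T -> nat).
Hypotheses (cY : counting_process Y) (iY : independent_increments P Y).

Lemma independent_increments_jump_count : independent_increments P (jump_count Y).
Proof.
move=> n t t0 tS; apply/full_independentP.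
have := jumpn_independent cY iY t0 tS; congr (full_independent P _).
apply/funext => j; apply/funext => w; rewrite (jump_countB cY)//; last exact: tS.
by apply: (nondecreasing_times_ge0 t0 tS); exact: ltnW.
Qed.

Lemma poisson_process_jump_count L : 0 < L -> has_jump_rate P Y L ->
  poisson_process P L (jump_count Y).
Proof.
move=> L0 HL; split=> //.
- exact: counting_process_jump_count.
- exact: jump_count0.
- exact: independent_increments_jump_count.
- by move=> s t s0 st U; apply: jump_count_law => //; exact: ltW.
Qed.

End JumpCountProcess.

(** * Sums of independent processes *)

Section ProcessSigma.
Context d (T : measurableType d) (R : realType) (P : probability T R).
Implicit Types X Y : R -> T -> nat.

Definition process_generators X : set_system T :=
  \bigcup_(t in [set t : R | 0 <= t]) preimage_set_system setT (X t) measurable.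

Lemma process_sigma_self X u : 0 <= u ->
  @measurable_fun _ _ (g_sigma_algebraType (process_generators X)) nat setT (X u).
Proof.
move=> u0 _ U mU; rewrite setTI; apply: sub_sigma_algebra.
by exists u => //; exists U => //; rewrite setTI.
Qed.

Lemma process_sigma_preimage X (f : T -> nat) (U : set nat) :
  @measurable_fun _ _ (g_sigma_algebraType (process_generators X)) nat setT f ->
  process_sigma X [set w | U (f w)].
Proof. by move=> mf; exact: (measurable_nat_preimage U mf). Qed.

Lemma process_sigma_sub X Y :
  (forall t U, 0 <= t -> process_sigma X [set w | U (Y t w)]) ->
  process_sigma Y `<=` process_sigma X.
Proof.
move=> H; apply: smallest_sub; first exact: smallest_sigma_algebra.
by move=> _ [t /= t0 [U _ <-]]; rewrite setTI; exact: H.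
Qed.

(** [measurable_jumpn] is applied with the sigma-algebra generated by [X] as ambient one.
    Independence of the components thus passes to their jump counts. *)
Lemma process_sigma_jump_count X : counting_process X ->
  process_sigma (jump_count X) `<=` process_sigma X.
Proof.
move=> cX; apply: process_sigma_sub => t U t0; apply: process_sigma_preimage.
apply: (@measurable_jumpn _ (g_sigma_algebraType (process_generators X))) => //.
  by move=> u u0; exact: process_sigma_self.
exact: counting_process_path cX.
Qed.

Lemma independent_processes_jump_count (I : finType) (M : I -> R -> T -> nat) :
  (forall i, counting_process (M i)) -> independent_processes P M ->
  independent_processes P (fun i => jump_count (M i)).
Proof.
move=> cM H J E HE; apply: H => i iJ.
by apply: (process_sigma_jump_count (cM i)); exact: HE.
Qed.

End ProcessSigma.

Section IndependentProcesses.
Context d (T : measurableType d) (R : realType) (P : probability T R).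
Variables (I : finType) (M : I -> R -> T -> nat).
Hypothesis hind : independent_processes P M.
Local Open Scope ereal_scope.

Lemma independent_processes_events (E : I -> set T) :
  (forall i, process_sigma (M i) (E i)) ->
  P [set w | forall i, E i w] = \prod_i P (E i).
Proof.
move=> HE; have := hind (J := finset.setT) (E := E) (fun i _ => HE i).
rewrite (_ : \bigcap_(i in _) _ = [set w | forall i, E i w]); last first.
  by apply/seteqP; split => w Hw i => [|_]; apply: Hw; rewrite /= inE.
by move=> ->; apply: eq_bigl => i; rewrite inE.
Qed.

Lemma independent_processes_rvs (f : I -> T -> nat) :
  (forall i U, process_sigma (M i) [set w | U (f i w)]) ->
  full_independent P f.
Proof.
move=> Hf U; apply: (independent_processes_events
  (E := fun i => [set w | U i (f i w)])) => i; exact: Hf.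
Qed.

(** For fixed [i] the constraints over [k] form one event of the sigma-algebra of [M i];
    independence across processes separates these events, then independence within each process
    factors them. *)
Lemma independent_processes_matrix (K : finType) (f : I -> K -> T -> nat) :
  (forall i k, @measurable_fun _ _ (g_sigma_algebraType (process_generators (M i)))
     nat setT (f i k)) ->
  (forall i, full_independent P (f i)) ->
  full_independent P (fun (p : K * I) => f p.2 p.1).
Proof.
move=> Hf Hi U.
rewrite (_ : [set w | _] =
    [set w | forall i, [set w' | forall k, U (k, i) (f i k w')] w]); last first.
  by apply/seteqP; split => w /= H => [i k|[k i]]; [exact: (H (k, i))|exact: H].
rewrite independent_processes_events.
  rewrite (eq_bigr (fun i => \prod_k P [set w | U (k, i) (f i k w)])); last first.
    by move=> i _; exact: (Hi i (fun k => U (k, i))).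
  rewrite exchange_big/= pair_big/=.
  by apply: eq_bigr => -[].
move=> i; apply: (@measurable_all_fin _
  (g_sigma_algebraType (process_generators (M i))) K) => k.
exact: process_sigma_preimage.
Qed.

End IndependentProcesses.

Section SumOfProcesses.
Context d (T : measurableType d) (R : realType) (P : probability T R).
Variables (I : finType) (M : I -> R -> T -> nat).
Hypothesis cM : forall i, counting_process (M i).

Definition partial_sum_process (J : pred I) : R -> T -> nat :=
  fun t w => (\sum_(i | J i) M i t w)%N.

Lemma counting_process_partial_sum J : counting_process (partial_sum_process J).
Proof.
split=> [t t0|w s t s0 st|w t t0].
- by apply: measurable_fun_sumn => i; exact: counting_process_measurable (cM i) _ t0.
- by apply: leq_sum => i _; case: (cM i) => _ + _; apply.
apply: (@cvg_trans _ (partial_sum_process J t w @[_ --> t^'+])); last exact: cvg_cst.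
apply: near_eq_cvg.
have : \forall u \near t^'+, forall i, M i u w = M i t w.
  apply: filter_forall => i; have [_ _ /(_ w t t0)] := cM i.
  by move=> /(_ _ (discrete_set1 _)).
by apply: filterS => u H; apply: eq_bigr => i _; rewrite H.
Qed.

Lemma partial_sum_processB J s t w : 0 <= s -> s <= t ->
  (partial_sum_process J t w - partial_sum_process J s w =
   \sum_(i | J i) (M i t w - M i s w))%N.
Proof.
move=> s0 st; rewrite sumnB// => i _.
by case: (cM i) => _ + _; apply.
Qed.

Hypotheses (iM : forall i, independent_increments P (M i))
           (hind : independent_processes P M).

Lemma increments_matrix_independent (n : nat) (t : nat -> R) :
  0 <= t 0 -> (forall j, (j < n)%N -> t j <= t j.+1) ->
  full_independent P (fun (p : 'I_n * I) w => (M p.2 (t p.1.+1) w - M p.2 (t p.1) w)%N).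
Proof.
move=> t0 tS; have t_ge0 := nondecreasing_times_ge0 t0 tS.
apply: (independent_processes_matrix hind
  (f := fun i (j : 'I_n) w => (M i (t j.+1) w - M i (t j) w)%N)).
  move=> i j; apply: measurable_increment.
  - by move=> u u0; exact: process_sigma_self.
  - exact/t_ge0/ltnW.
  - exact: t_ge0.
by move=> i; apply/full_independentP; exact: iM.
Qed.

Lemma independent_increments_partial_sum J :
  independent_increments P (partial_sum_process J).
Proof.
move=> n t t0 tS; apply/full_independentP.
have t_ge0 := nondecreasing_times_ge0 t0 tS.
pose inc (p : 'I_n * I) w := (M p.2 (t p.1.+1) w - M p.2 (t p.1) w)%N.
have minc p : measurable_fun setT (inc p).
  apply: measurable_increment.
  - by move=> u u0; exact: counting_process_measurable.
  - exact/t_ge0/ltnW.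
  - exact: t_ge0.
(* Row [j] of the matrix is a block; components outside [J] are sent to 0, so the block sum is the
   increment of the partial sum. *)
have := full_independent_block_sums fst
  (fun p x => if J p.2 then x else 0%N) minc (increments_matrix_independent t0 tS).
congr (full_independent P _).
apply/funext => j; apply/funext => w.
rewrite (eq_bigl (fun p : 'I_n * I => (p.1 == j) && xpredT p.2)); last first.
  by move=> p; rewrite andbT.
rewrite -(pair_big (pred1 j) xpredT
  (fun a i => if J i then inc (a, i) w else 0%N))/=.
rewrite big_pred1_eq -big_mkcond/= partial_sum_processB//; last exact: tS.
exact/t_ge0/ltnW.
Qed.

End SumOfProcesses.

(** * Rates and jump counts of sums *)

Section JumpRateOfSums.
Context d (T : measurableType d) (R : realType) (P : probability T R).

(** The factor [1 - \prod] is the probability that at least one of several independent components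
    moves in a cell. With Q the product over the tail of the list, 1 - (1 - p) Q = p Q + (1 - Q),
    and Q tends to 1. *)
Lemma thin_union_cvg (I : Type) (J : pred I) (r : seq I) (p : I -> nat -> R) (x : I -> R) :
  (forall i, (2 ^ n)%:R * p i n @[n --> \oo] --> x i) ->
  (2 ^ n)%:R * (1 - \prod_(i <- r | J i) (1 - p i n)) @[n --> \oo] -->
  \sum_(i <- r | J i) x i.
Proof.
move=> px; elim: r => [|i r IH].
  rewrite big_nil; apply: (@cvg_near_eq _ (fun=> 0)); first exact: cvg_cst.
  by apply: nearW => n; rewrite big_nil subrr mulr0.
rewrite big_cons; case: ifPn => Ji; last first.
  by apply: cvg_near_eq IH _; apply: nearW => n; rewrite big_cons (negPf Ji).
have Q1 : \prod_(i <- r | J i) (1 - p i n) @[n --> \oo] --> (1 : R).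
  have Q0 := thin_cvg0 IH.
  rewrite -[X in _ --> X]subr0; apply: cvg_near_eq; first exact: (cvgB (cvg_cst (1 : R)) Q0).
  by apply: nearW => n /=; rewrite opprB addrC subrK.
rewrite -(mulr1 (x i)); apply: cvg_near_eq; first exact: (cvgD (cvgM (px i) Q1) IH).
by apply: nearW => n /=; rewrite big_cons Ji; ring.
Qed.

Local Open Scope ereal_scope.

Lemma prob_exists_le (K : finType) (c : pred K) (F : K -> set T) :
  (forall k, measurable (F k)) ->
  P [set w | exists2 k, c k & F k w] <= \sum_(k | c k) P (F k).
Proof.
move=> mF.
pose S (r : seq K) := [set w | exists k, [/\ k \in r, c k & F k w]].
suff H r : measurable (S r) /\ P (S r) <= \sum_(k <- r | c k) P (F k).
  rewrite (_ : [set w | _] = S (index_enum K)); first by have [] := H (index_enum K).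
  apply/seteqP; split => w /= [k]; first by exists k; rewrite mem_index_enum.
  by move=> [_ ck Fk]; exists k.
elim: r => [|k r [mS IH]].
  rewrite (_ : S [::] = set0) ?measure0 ?big_nil//.
  by apply/seteqP; split => w //= [k []].
rewrite big_cons; case: ifPn => ck.
  rewrite (_ : S (k :: r) = F k `|` S r); last first.
    apply/seteqP; split => w /=.
      move=> [k' []]; rewrite inE => /predU1P[->|k'r] ck' Fk'; first by left.
      by right; exists k'.
    move=> [Fk|[k' [k'r ck' Fk']]]; first by exists k; rewrite mem_head.
    by exists k'; rewrite inE k'r orbT.
  split; first exact: measurableU.
  by apply: le_trans (measureU2 _ _ _) _ => //; exact: leeD2l.
rewrite (_ : S (k :: r) = S r)//.
apply/seteqP; split => w /= [k' []].
  by rewrite inE => /predU1P[->|k'r]; [rewrite (negPf ck)|exists k'].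
by move=> k'r ck' Fk'; exists k'; rewrite inE k'r orbT.
Qed.

Variables (I : finType) (M : I -> R -> T -> nat) (L : I -> R).
Hypotheses (cM : forall i, counting_process (M i))
           (hind : independent_processes P M)
           (HL : forall i, has_jump_rate P (M i) (L i)).

Let inc i s t n j w := (M i (grid s t n j.+1) w - M i (grid s t n j) w)%N.

Let sigma_inc i s t n j (U : set nat) : (0 <= s)%R -> (s <= t)%R ->
  process_sigma (M i) [set w | U (inc i s t n j w)].
Proof.
move=> s0 st; apply: process_sigma_preimage; apply: measurable_increment.
- by move=> u u0; exact: process_sigma_self.
- by rewrite (le_trans s0)// grid_ge.
- by rewrite (le_trans s0)// grid_ge.
Qed.

Let minc i s t n j (U : set nat) : (0 <= s)%R -> (s <= t)%R ->
  measurable [set w | U (inc i s t n j w)].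
Proof.
move=> s0 st; apply: measurable_nat_preimage; apply: measurable_increment.
- by move=> u u0; exact: counting_process_measurable.
- by rewrite (le_trans s0)// grid_ge.
- by rewrite (le_trans s0)// grid_ge.
Qed.

Lemma has_jump_rate_partial_sum (J : pred I) :
  has_jump_rate P (partial_sum_process M J) (\sum_(i | J i) L i)%R.
Proof.
move=> s t s0 st.
have /choice[p Hp] : forall i, exists p : nat -> R,
    (forall n j, (j < 2 ^ n)%N ->
      P [set w | (0 < inc i s t n j w)%N] = (p n)%:E) /\
    ((2 ^ n)%:R * p n)%R @[n --> \oo] --> (L i * (t - s))%R.
  by move=> i; have [p ? ?] := HL i s0 st; exists p.
exists (fun n => 1 - \prod_(i | J i) (1 - p i n))%R; last first.
  rewrite mulr_suml; apply: thin_union_cvg => i; exact: (Hp i).2.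
move=> n j jn.
under eq_set do rewrite partial_sum_processB ?grid_le// ?(le_trans s0) ?grid_ge//.
pose V i := if J i then [set 0%N] else setT.
have -> : [set w | (0 < \sum_(i | J i)
    (M i (grid s t n j.+1) w - M i (grid s t n j) w))%N] =
    ~` [set w | forall i, V i (inc i s t n j w)].
  apply/seteqP; split => w /=.
    rewrite lt0n => /eqP S0 H; apply: S0; apply: big1 => i Ji.
    by have := H i; rewrite /V Ji.
  move=> H; rewrite lt0n; apply/eqP => S0; apply: H => i; rewrite /V.
  case: ifPn => // Ji; apply/eqP; rewrite -leqn0 -[X in (_ <= X)%N]S0.
  by rewrite (bigD1 i)//= leq_addr.
rewrite probability_setC; last by apply: measurable_all_fin => i; exact: minc.
rewrite (independent_processes_rvs hind (f := fun i => inc i s t n j)); last first.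
  by move=> i U; exact: sigma_inc.
rewrite (eq_bigr (fun i => (if J i then 1 - p i n else 1)%R%:E)) => [|i _].
  by rewrite -(big_morph EFin EFinM erefl) -big_mkcond.
rewrite /V; case: ifPn => Ji; last exact: probability_setT.
have -> : [set w | [set 0%N] (inc i s t n j w)] = ~` [set w | (0 < inc i s t n j w)%N].
  by apply/seteqP; split => w /=; [move=> ->|move/negP; rewrite lt0n negbK => /eqP].
rewrite probability_setC ?(Hp i).1//.
exact: (minc i n j (fun m => (0 < m)%N) s0 st).
Qed.

(** If no two components move in a common cell, truncating their sum at 1 is the same as truncating
    each term, so the dyadic sums agree. *)
Lemma jump_count_partial_sum (J : pred I) t : (0 <= t)%R ->
  P [set w | jump_count (partial_sum_process M J) t w <>
             (\sum_(i | J i) jump_count (M i) t w)%N] = 0.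
Proof.
move=> t0.
have /choice[p Hp] : forall i, exists p : nat -> R,
    (forall n j, (j < 2 ^ n)%N ->
      P [set w | (0 < inc i 0 t n j w)%N] = (p n)%:E) /\
    ((2 ^ n)%:R * p n)%R @[n --> \oo] --> (L i * (t - 0))%R.
  by move=> i; have [p ? ?] := HL i (lexx 0%R) t0; exists p.
have cY := counting_process_partial_sum cM J.
pose B n := [set w | dyadic_sum 1 (partial_sum_process M J ^~ w) 0 t n <>
                     (\sum_(i | J i) dyadic_sum 1 (M i ^~ w) 0 t n)%N].
(* Union bound over cells and ordered pairs of distinct components: [2 ^ n] times the first
   probability converges, while the second tends to 0. *)
pose bound n := (\sum_(p' : I * I | p'.1 != p'.2)
   (2 ^ n)%:R * p p'.1 n * p p'.2 n)%R.
have mneq (f g : T -> nat) : measurable_fun setT f -> measurable_fun setT g ->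
    measurable [set w | f w <> g w].
  exact: (measurable_fun_nat_rel (fun a b => a <> b)).
have mB n : measurable (B n).
  apply: mneq; last apply: measurable_fun_sumn => i.
    by apply: measurable_dyadic_sum => // u u0; exact: (counting_process_measurable cY).
  by apply: measurable_dyadic_sum => // u u0; exact: (counting_process_measurable (cM i)).
have mE : measurable [set w | jump_count (partial_sum_process M J) t w <>
             (\sum_(i | J i) jump_count (M i) t w)%N].
  apply: mneq; last apply: measurable_fun_sumn => i.
    exact: (counting_process_measurable (counting_process_jump_count cY)).
  exact: (counting_process_measurable (counting_process_jump_count (cM i))).
have PB n : P (B n) <= (bound n)%:E.
  pose F (k : 'I_(2 ^ n) * (I * I)) :=
    [set w | (0 < inc k.2.1 0 t n k.1 w)%N] `&` [set w | (0 < inc k.2.2 0 t n k.1 w)%N].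
  have mF k : measurable (F k).
    by apply: measurableI; exact: (minc _ _ _ (fun m => (0 < m)%N) (lexx _) t0).
  apply: (@le_trans _ _ (P [set w | exists2 k, k.2.1 != k.2.2 & F k w])).
    apply: le_measure; rewrite ?inE//.
      rewrite (_ : [set w | _] = \bigcup_(k in [set k | k.2.1 != k.2.2]) F k)//.
      by apply: fin_bigcup_measurable; [exact: finite_finset|move=> k _; exact: mF].
    move=> w /= Bw; apply: contrapT => H; apply: Bw.
    rewrite exchange_big/=; apply: eq_bigr => j _.
    rewrite partial_sum_processB ?grid_le ?grid_ge//.
    have [[i Ji i0]|none] := pselect (exists2 i, J i & (0 < inc i 0 t n j w)%N).
      have others i' : i' != i -> inc i' 0 t n j w = 0%N.
        move=> ii'; apply/eqP; rewrite -leqn0 leqNgt; apply/negP => i'0.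
        by apply: H; exists (j, (i', i)).
      rewrite (bigD1 i)//= [in RHS](bigD1 i)//= !big1 ?addn0//.
        by move=> i' /andP[_ /others]; rewrite /inc => ->.
      by move=> i' /andP[_ /others]; rewrite /inc => ->.
    have all0 i : J i -> inc i 0 t n j w = 0%N.
      move=> Ji; apply/eqP; rewrite -leqn0 leqNgt; apply/negP => i0.
      by apply: none; exists i.
    by rewrite !big1// => i /all0; rewrite /inc => ->.
  apply: le_trans (prob_exists_le _ mF) _.
  rewrite (eq_bigr (fun k => (p k.2.1 n * p k.2.2 n)%R%:E)); last first.
    move=> k kk.
    have := full_independent2 [set m | (0 < m)%N] [set m | (0 < m)%N]
      (independent_processes_rvs hind (f := fun i => inc i 0 t n k.1)
         (fun i U => @sigma_inc i _ t n k.1 U (lexx _) t0)) kk.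
    rewrite /F EFinM -((Hp k.2.1).1 n k.1 (ltn_ord _)).
    by rewrite -((Hp k.2.2).1 n k.1 (ltn_ord _)) /= => <-.
  rewrite sumEFin lee_fin le_eqVlt; apply/orP; left; apply/eqP.
  rewrite -(pair_big xpredT (fun p' : I * I => p'.1 != p'.2)
    (fun _ p' => p p'.1 n * p p'.2 n)%R)/= exchange_big/=.
  by apply: eq_bigr => p' _; rewrite sumr_const card_ord -[LHS]mulr_natl mulrA.
have bound0 : bound n @[n --> \oo] --> (0%R : R).
  rewrite (_ : 0 = \sum_(p' : I * I | p'.1 != p'.2) 0)%R; last by rewrite big1.
  apply: cvg_sum_fin => p' _; rewrite -(mulr0 (L p'.1 * (t - 0))%R).
  by apply: cvgM; [exact: (Hp _).2|exact: (thin_cvg0 (Hp _).2)].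
have H1 : P (B n) @[n --> \oo] --> P [set w | jump_count (partial_sum_process M J) t w <>
             (\sum_(i | J i) jump_count (M i) t w)%N].
  apply: prob_cvg => // w.
  have h1 := dyadic_sum_cvg (counting_process_path cY w) (lexx _) t0.
  have h2 : \forall n \near \oo, forall i,
      dyadic_sum 1 (M i ^~ w) 0 t n = jump_count (M i) t w.
    by apply: filter_forall => i; exact: (dyadic_sum_cvg (counting_process_path (cM i) w)).
  near=> n; rewrite /B /=.
  have -> : dyadic_sum 1 (partial_sum_process M J ^~ w) 0 t n =
            jump_count (partial_sum_process M J) t w by near: n.
  have H i : dyadic_sum 1 (M i ^~ w) 0 t n = jump_count (M i) t w.
    by move: i; near: n.
  by rewrite (eq_bigr _ (fun i _ => H i)).
apply: (cvg_unique _ H1) => //.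
apply: (squeeze_cvge (f := fun=> 0) (h := fun n => (bound n)%:E)).
- by apply: nearW => n; rewrite measure_ge0 PB.
- exact: cvg_cst.
- by apply: cvg_EFin => //; exact: nearW.
Unshelve. all: by end_near. Qed.

End JumpRateOfSums.

(** * Small-time rates and moments of a GCP *)

Section GCPRates.
Context d (T : measurableType d) (R : realType) (P : probability T R).

(** With [h = t / 2 ^ n] the sequence is [t] times [f h / h], hence the tolerance [e / t]. *)
Lemma littleo_dyadic (f : R -> R) (t : R) :
  f =o_ ((0 : R)^'+) (fun h => h) -> 0 < t ->
  (2 ^ n)%:R * f (t / (2 ^ n)%:R) @[n --> \oo] --> (0 : R).
Proof.
move=> /eqoP fo t0; apply/cvgr0Pnorm_le => e e0.
have [a a0 Ha] := fo (e / t) (divr_gt0 e0 t0).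
have : \forall n \near \oo, t / (2 ^ n)%:R < a.
  have H : t / (2 ^ n)%:R @[n --> \oo] --> (0 : R).
    by rewrite -(mulr0 t); apply: cvgM; [exact: cvg_cst|exact: cvg_inv_exp2].
  by apply: (@cvgr_lt _ _ \oo _ _ 0).
apply: filterS => n tna.
have h0 : 0 < t / (2 ^ n)%:R by rewrite divr_gt0// natr_exp2_gt0.
have := Ha (t / (2 ^ n)%:R); rewrite /= sub0r normrN gtr0_norm// => /(_ tna h0).
rewrite normrM ger0_norm// -ler_pdivlMl ?natr_exp2_gt0//.
move=> /le_trans; apply; rewrite le_eqVlt; apply/orP; left; apply/eqP; field.
by rewrite natr_exp2_neq0 gt_eqF.
Qed.

Variables (k : nat) (lam : nat -> R) (X : R -> T -> nat).
Hypothesis gX : generalized_counting_process P k lam X.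

Let cX : counting_process X. Proof. by case: gX. Qed.
Let X0 w : X 0 w = 0%N. Proof. by case: gX. Qed.
Let iX : independent_increments P X. Proof. by case: gX => _ _ _ []. Qed.
Let mX u : 0 <= u -> measurable_fun setT (X u).
Proof. exact: counting_process_measurable. Qed.
Let msX u U : 0 <= u -> measurable [set w | U (X u w)].
Proof. by move=> u0; apply: measurable_nat_preimage; exact: mX. Qed.

Local Notation pr A := (fine (P A)).

Lemma total_rate_gt0 : 0 < total_rate k lam.
Proof.
have [[k0 lam0] _ _ _ _] := gX.
rewrite /total_rate big_ltn// ltr_wpDr ?lam0//.
rewrite big_nat sumr_ge0// => j /andP[j1 jk]; apply/ltW/lam0.
by rewrite (ltnW j1).
Qed.

Lemma increment_law s h U : 0 <= s -> 0 <= h ->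
  P [set w | U (X (s + h)%R w - X s w)%N] = P [set w | U (X h w)].
Proof.
move=> s0 h0; have [_ _ _ [_ sX] _] := gX.
rewrite (sX s 0 h s0 (lexx 0) h0 U); congr (P _).
by apply/funext => w; rewrite /mkset add0r X0 subn0.
Qed.

Lemma grid_increment_law s t n j U : 0 <= s -> s <= t ->
  P [set w | U (X (grid s t n j.+1) w - X (grid s t n j) w)%N] =
  P [set w | U (X ((t - s) / (2 ^ n)%:R) w)].
Proof.
move=> s0 st; rewrite -(@increment_law (grid s t n j)).
- by rewrite -(gridB s t n j) addrC subrK.
- by rewrite (le_trans s0)// grid_ge.
- by rewrite divr_ge0// subr_ge0.
Qed.

(** At time 0 the conditioning event is the whole space, so the rates become unconditional;
    stationarity then moves them to any cell. *)
Let cond0 h j : cond_pr P [set w | X (0 + h) w = (0 + j)%N] [set w | X 0 w = 0%N] =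
  pr [set w | X h w = j].
Proof.
have -> : [set w | X 0 w = 0%N] = setT by apply/seteqP; split=> // w _; exact: X0.
by rewrite /cond_pr setIT probability_setT divr1 add0r add0n.
Qed.

Let small_time : let p (j : nat) (h : R) := pr [set w | X h w = j] in
  [/\ (fun h => p 0%N h - (1 - total_rate k lam * h)) =o_ ((0 : R)^'+) (fun h => h)
    & forall j, (1 <= j <= k)%N ->
            (fun h => p j h - lam j * h) =o_ ((0 : R)^'+) (fun h => h)].
Proof.
have [_ _ _ _ H] := gX.
have P0 : P [set w | X 0 w = 0%N] != 0%E.
  rewrite (_ : [set w | _] = setT) ?probability_setT ?onee_neq0//.
  by apply/seteqP; split=> // w _; exact: X0.
have [H0 Hj _] := H 0 0%N (lexx _) P0.
pose c j h := cond_pr P [set w | X (0 + h) w = (0 + j)%N] [set w | X 0 w = 0%N].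
split=> [|j jk].
  have -> : (fun h => pr [set w | X h w = 0%N] - (1 - total_rate k lam * h)) =
            (fun h => c 0%N h - (1 - total_rate k lam * h)).
    by apply/funext => h; rewrite /c cond0.
  exact: H0.
have -> : (fun h => pr [set w | X h w = j] - lam j * h) = (fun h => c j h - lam j * h).
  by apply/funext => h; rewrite /c cond0.
exact: Hj.
Qed.

Let X0_dyadic (n : nat) w : X (0 / (2 ^ n)%:R) w = 0%N.
Proof. by rewrite mul0r X0. Qed.

Lemma gcp_rate0 t : 0 <= t ->
  (2 ^ n)%:R * (1 - pr [set w | X (t / (2 ^ n)%:R) w = 0%N]) @[n --> \oo] -->
  total_rate k lam * t.
Proof.
rewrite le_eqVlt => /predU1P[<-|t0].
  rewrite mulr0; apply: (@cvg_near_eq _ (fun=> 0)); first exact: cvg_cst.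
  apply: nearW => n; rewrite (_ : [set w | _] = setT) ?probability_setT ?subrr ?mulr0//.
  by apply/seteqP; split=> // w _; exact: X0_dyadic.
have [H _] := small_time; have := littleo_dyadic H t0.
move=> /cvgN; rewrite oppr0 => H'.
rewrite -[X in _ --> X]addr0; apply: cvg_near_eq.
  exact: (cvgD (cvg_cst (total_rate k lam * t)) H').
by apply: nearW => n; rewrite ?fctE /=; field; rewrite natr_exp2_neq0.
Qed.

Lemma gcp_rate t j : 0 <= t -> (1 <= j <= k)%N ->
  (2 ^ n)%:R * pr [set w | X (t / (2 ^ n)%:R) w = j] @[n --> \oo] --> lam j * t.
Proof.
rewrite le_eqVlt => /predU1P[<-|t0] jk.
  rewrite mulr0; apply: (@cvg_near_eq _ (fun=> 0)); first exact: cvg_cst.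
  apply: nearW => n; rewrite (_ : [set w | _] = set0) ?measure0 ?mulr0//.
  apply/seteqP; split=> // w; rewrite /mkset X0_dyadic => j0.
  by move: jk; rewrite -j0.
have [_ /(_ j jk) H] := small_time; have H' := littleo_dyadic H t0.
rewrite -[X in _ --> X]addr0; apply: cvg_near_eq.
  exact: (cvgD (cvg_cst (lam j * t)) H').
by apply: nearW => n; rewrite ?fctE /=; field; rewrite natr_exp2_neq0.
Qed.

Lemma gcp_has_jump_rate : has_jump_rate P X (total_rate k lam).
Proof.
move=> s t s0 st.
exists (fun n => 1 - pr [set w | X ((t - s) / (2 ^ n)%:R) w = 0%N]); last first.
  by apply: gcp_rate0; rewrite subr_ge0.
move=> n j jn; rewrite (grid_increment_law n j (fun m => (0 < m)%N))//.
have h0 : 0 <= (t - s) / (2 ^ n)%:R by rewrite divr_ge0// subr_ge0.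
have -> : [set w | (0 < X ((t - s) / (2 ^ n)%:R) w)%N] =
    ~` [set w | X ((t - s) / (2 ^ n)%:R) w = 0%N].
  by apply/seteqP; split => w /=; [rewrite lt0n => /eqP|move=> /eqP; rewrite lt0n].
have m0 := msX [set 0%N] h0.
by rewrite probability_setC// EFinB fineK// prob_fin.
Qed.

Lemma prob_nat_split (Z : T -> nat) : measurable_fun setT Z ->
  pr [set w | (k < Z w)%N] = 1 - pr [set w | Z w = 0%N] -
    \sum_(1 <= j < k.+1) pr [set w | Z w = j].
Proof.
move=> mZ; have msZ (U : set nat) := measurable_nat_preimage U mZ.
have H : ((\sum_(0 <= j < k.+1) pr [set w | Z w = j])%:E +
    P [set w | (k < Z w)%N] = 1)%E.
  rewrite -sumEFin.
  rewrite (eq_bigr (fun j => P [set w | Z w = j])) => [|j _]; last first.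
    by rewrite fineK// prob_fin//; exact: (msZ [set j]).
  rewrite big_mkord -prob_disjoint_union; last 2 first.
  - by move=> j; exact: (msZ [set (j : nat)]).
  - by move=> i j w /= Zi Zj; apply: val_inj; rewrite /= -Zi -Zj.
  rewrite -measureU; last 3 first.
  - rewrite (_ : [set w | _] = [set w | (Z w <= k)%N]).
      exact: (msZ (fun m => (m <= k)%N)).
    apply/seteqP; split => w /=.
      by move=> [j _ ->]; rewrite -ltnS.
    by move=> Zk; exists (Ordinal (Zk : (Z w < k.+1)%N)).
  - exact: (msZ (fun m => (k < m)%N)).
  - apply/seteqP; split => w //= [[j _ ->]].
    by rewrite ltnNge -ltnS ltn_ord.
  rewrite -(@probability_setT _ _ _ P); congr (P _).
  apply/seteqP; split=> // w _ /=; have [kZ|Zk] := ltnP k (Z w); first by right.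
  by left; exists (Ordinal (Zk : (Z w < k.+1)%N)).
have mk := msZ (fun m => (k < m)%N).
rewrite -(fineK (prob_fin P mk)) -EFinD in H; case: H => H.
by move: H; rewrite big_ltn// => H; lra.
Qed.

(** Bounds o(h) cannot be added over infinitely many values, so the tail is taken as the complement
    of 0, ..., [k]; the rates cancel because [total_rate] is the sum of the [lam j]. *)
Lemma gcp_rate_large t : 0 <= t ->
  (2 ^ n)%:R * pr [set w | (k < X (t / (2 ^ n)%:R) w)%N] @[n --> \oo] --> (0 : R).
Proof.
move=> t0.
have H1 := gcp_rate0 t0.
have H2 : \sum_(1 <= j < k.+1) (2 ^ n)%:R * pr [set w | X (t / (2 ^ n)%:R) w = j]
    @[n --> \oo] --> \sum_(1 <= j < k.+1) lam j * t.
  under eq_cvg do rewrite big_nat.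
  by rewrite big_nat; apply: cvg_sum_fin => j jk; exact: gcp_rate.
rewrite -mulr_suml -/(total_rate k lam) in H2.
rewrite -(subrr (total_rate k lam * t)).
apply: cvg_near_eq; first exact: (cvgB H1 H2).
apply: nearW => n; rewrite ?fctE /= prob_nat_split; last first.
  by apply: mX; rewrite divr_ge0.
by rewrite -mulr_sumr; ring.
Qed.

(** No moment of [X] is known at this stage; constancy of [f] beyond [k] gathers all large values
    into one term weighted by a probability o(h). *)
Lemma gcp_small_time_expectation (f : nat -> nat) t : 0 <= t ->
  f 0%N = 0%N -> (forall n, (k < n)%N -> f n = f k.+1) ->
  (forall n, (\int[P]_w ((f (X (t / (2 ^ n)%:R) w))%:R%:E))%E \is a fin_num) /\
  (2 ^ n)%:R * fine (\int[P]_w ((f (X (t / (2 ^ n)%:R) w))%:R%:E))%E @[n --> \oo] -->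
  (\sum_(1 <= j < k.+1) (f j)%:R * lam j) * t.
Proof.
move=> t0 f0 fk.
have h0 n : 0 <= t / (2 ^ n)%:R by rewrite divr_ge0.
have E n : (\int[P]_w ((f (X (t / (2 ^ n)%:R) w))%:R%:E))%E =
   (\sum_(1 <= j < k.+1) ((f j)%:R * pr [set w | X (t / (2 ^ n)%:R) w = j]) +
   (f k.+1)%:R * pr [set w | (k < X (t / (2 ^ n)%:R) w)%N])%:E.
  rewrite (integral_natr_finite P (mX (h0 n)) f0 fk) EFinD -sumEFin.
  rewrite [in RHS]EFinM fineK; last exact/prob_fin/(msX (fun m => (k < m)%N)).
  congr (_ + _)%E; apply: eq_bigr => j _.
  by rewrite EFinM fineK//; apply: prob_fin; exact: (msX [set j]).
split=> [n|]; first by rewrite E.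
have H1 : \sum_(1 <= j < k.+1)
      (f j)%:R * ((2 ^ n)%:R * pr [set w | X (t / (2 ^ n)%:R) w = j])
    @[n --> \oo] --> \sum_(1 <= j < k.+1) (f j)%:R * (lam j * t).
  under eq_cvg do rewrite big_nat.
  rewrite big_nat; apply: cvg_sum_fin => j jk.
  by apply: cvgM; [exact: cvg_cst|exact: gcp_rate].
have H2 : (f k.+1)%:R * ((2 ^ n)%:R * pr [set w | (k < X (t / (2 ^ n)%:R) w)%N])
    @[n --> \oo] --> ((f k.+1)%:R * 0 : R).
  by apply: cvgM; [exact: cvg_cst|exact: gcp_rate_large].
have -> : (\sum_(1 <= j < k.+1) (f j)%:R * lam j) * t =
    \sum_(1 <= j < k.+1) (f j)%:R * (lam j * t) + (f k.+1)%:R * 0.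
  by rewrite mulr0 addr0 mulr_suml; apply: eq_bigr => j _; rewrite mulrA.
apply: cvg_near_eq; first exact: (cvgD H1 H2).
apply: nearW => n; rewrite E /= mulrDr mulr_sumr.
congr (_ + _); last by rewrite mulrCA.
by apply: eq_bigr => j _; rewrite mulrCA.
Qed.

End GCPRates.

Section MonotoneLimits.
Context d (T : measurableType d) (R : realType) (P : probability T R).
Local Open Scope ereal_scope.

Lemma integral_natr_eq_law (X Y : T -> nat) (f : nat -> nat) :
  measurable_fun setT X -> measurable_fun setT Y ->
  (forall U : set nat, P [set w | U (X w)] = P [set w | U (Y w)]) ->
  \int[P]_w ((f (X w))%:R%:E) = \int[P]_w ((f (Y w))%:R%:E).
Proof.
move=> mX mY XY.
rewrite (@integral_natr _ _ _ P (f \o X)); last exact: measurable_nat_comp.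
rewrite (@integral_natr _ _ _ P (f \o Y)); last exact: measurable_nat_comp.
by apply: eq_eseriesr => a _; exact: (XY (fun m => (a < f m)%N)).
Qed.

Lemma integral_nat_limit (u : nat -> T -> nat) (Z : T -> nat) (N : set T) :
  (forall n, measurable_fun setT (u n)) -> measurable_fun setT Z ->
  (forall w, {homo u ^~ w : m n / (m <= n)%N}) ->
  measurable N -> P N = 0 ->
  (forall w, ~ N w -> \forall n \near \oo, u n w = Z w) ->
  \int[P]_w ((u n w)%:R%:E) @[n --> \oo] --> \int[P]_w ((Z w)%:R%:E).
Proof.
move=> mu mZ u_nd mN PN uZ.
have drop (V : T -> nat) : measurable_fun setT V ->
    \int[P]_w ((V w)%:R%:E) = \int[P]_(w in ~` N) ((V w)%:R%:E).
  move=> mV; rewrite (ge0_negligible_integral mN measurableT)//.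
    by rewrite setTD.
  exact: measurable_natr_EFin.
rewrite (drop Z)//; under eq_cvg do rewrite drop//.
have H := @cvg_monotone_convergence _ _ _ P (~` N) (measurableC mN)
  (fun n w => (u n w)%:R%:E).
rewrite (eq_integral (fun w => limn (fun n => (u n w)%:R%:E))); last first.
  move=> w /set_mem Nw; apply/esym/lim_near_cst => //.
  by apply: filterS (uZ w Nw) => n ->.
apply: H.
- by move=> n; apply: (measurable_funS measurableT) => //; exact: measurable_natr_EFin.
- by move=> n w _; rewrite lee_fin.
- by move=> w _ m n mn; rewrite lee_fin ler_nat u_nd.
Qed.

End MonotoneLimits.

(** * Moments of dyadic sums *)

Section DyadicMoments.
Context d (T : measurableType d) (R : realType) (P : probability T R).
Variables (k : nat) (lam : nat -> R) (X : R -> T -> nat).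
Hypothesis gX : generalized_counting_process P k lam X.

Let cX : counting_process X. Proof. by case: gX. Qed.
Let iX : independent_increments P X. Proof. by case: gX => _ _ _ []. Qed.
Let mX u : 0 <= u -> measurable_fun setT (X u).
Proof. exact: counting_process_measurable. Qed.

Variable t : R.
Hypothesis t0 : 0 <= t.

Let h n : R := t / (2 ^ n)%:R.
Let inc n (j : 'I_(2 ^ n)) w := (X (grid 0 t n j.+1) w - X (grid 0 t n j) w)%N.

Let h0 n : 0 <= h n. Proof. by rewrite divr_ge0. Qed.

Let minc n j : measurable_fun setT (@inc n j).
Proof. by apply: measurable_increment; rewrite // grid_ge. Qed.

Let inc_law n j (U : set nat) : P [set w | U (@inc n j w)] = P [set w | U (X (h n) w)].
Proof. by rewrite (grid_increment_law gX n j U (lexx 0) t0) subr0. Qed.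

Section Functions.
Variables f g : nat -> nat.
Hypotheses (f0 : f 0%N = 0%N) (fk : forall n, (k < n)%N -> f n = f k.+1).
Hypotheses (g0 : g 0%N = 0%N) (gk : forall n, (k < n)%N -> g n = g k.+1).

Let S (f : nat -> nat) n w := (\sum_(j < 2 ^ n) f (inc j w))%N.
Let e (f : nat -> nat) n := fine (\int[P]_w ((f (X (h n) w))%:R%:E))%E.

Lemma integral_dyadic_sum n :
  (\int[P]_w ((S f n w)%:R%:E) = ((2 ^ n)%:R * e f n)%:E)%E.
Proof.
transitivity (\int[P]_w (\sum_(j < 2 ^ n) (f (inc j w))%:R%:E))%E.
  by apply: eq_integral => w _; rewrite sumEFin -natr_sum.
rewrite ge0_integral_sum//; last first.
  by move=> j; apply: measurable_natr_EFin; exact: measurable_nat_comp.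
rewrite (eq_bigr (fun=> (e f n)%:E)) => [|j _].
  by rewrite sumEFin sumr_const card_ord -[X in X%:E = _]mulr_natl.
rewrite /e fineK; last exact: (gcp_small_time_expectation gX t0 f0 fk).1.
by apply: integral_natr_eq_law => [||U]; [exact: minc|exact: mX|exact: inc_law].
Qed.

(** The double sum over cells has [2 ^ n] diagonal terms; the [2 ^ n * (2 ^ n - 1)] others factor,
    as increments over distinct cells are independent. *)
Lemma integral_dyadic_sum_mul n :
  (\int[P]_w ((S f n w * S g n w)%N%:R%:E) =
   ((2 ^ n)%:R * e (fun m => f m * g m)%N n +
    (2 ^ n)%:R * ((2 ^ n)%:R - 1) * (e f n * e g n))%:E)%E.
Proof.
have ef : (\int[P]_w ((f (X (h n) w))%:R%:E) = (e f n)%:E)%E.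
  by rewrite /e fineK//; exact: (gcp_small_time_expectation gX t0 f0 fk).1.
have eg : (\int[P]_w ((g (X (h n) w))%:R%:E) = (e g n)%:E)%E.
  by rewrite /e fineK//; exact: (gcp_small_time_expectation gX t0 g0 gk).1.
have fg0 : (f 0 * g 0 = 0)%N by rewrite f0.
have fgk m : (k < m)%N -> (f m * g m = f k.+1 * g k.+1)%N.
  by move=> km; rewrite fk// gk.
have efg : (\int[P]_w ((f (X (h n) w) * g (X (h n) w))%N%:R%:E) =
    (e (fun m => f m * g m)%N n)%:E)%E.
  by rewrite /e fineK//; exact: (gcp_small_time_expectation gX t0 fg0 fgk).1.
have mfg j l : measurable_fun setT
    (fun w => ((f (@inc n j w) * g (@inc n l w))%N%:R : R)%:E).
  under eq_fun do rewrite natrM EFinM.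
  by apply: emeasurable_funM; apply: measurable_natr_EFin; exact: measurable_nat_comp.
transitivity (\int[P]_w (\sum_(j < 2 ^ n) \sum_(l < 2 ^ n)
    (f (inc j w) * g (inc l w))%N%:R%:E))%E.
  apply: eq_integral => w _; rewrite /S big_distrlr/= natr_sum -sumEFin.
  by apply: eq_bigr => j _; rewrite natr_sum -sumEFin.
rewrite ge0_integral_sum//; last 2 first.
- by move=> j; apply: emeasurable_sum => l; exact: mfg.
- by move=> j w _; apply: sume_ge0 => l _; rewrite lee_fin.
rewrite (eq_bigr (fun j : 'I_(2 ^ n) => (e (fun m => f m * g m)%N n +
    ((2 ^ n)%:R - 1) * (e f n * e g n))%:E)).
  rewrite sumEFin sumr_const card_ord -[X in X%:E = _]mulr_natl.
  by rewrite mulrDr mulrA.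
move=> j _; rewrite ge0_integral_sum//.
rewrite (bigD1 j)//= EFinD; congr (_ + _)%E.
  rewrite -efg; apply: (@integral_natr_eq_law _ _ _ P (inc j) (X (h n))
    (fun m => f m * g m)%N) => [||U]; [exact: minc|exact: mX|exact: inc_law].
rewrite (eq_bigr (fun=> (e f n * e g n)%:E)) => [|l lj].
  rewrite sumEFin sumr_const -[X in X%:E = _]mulr_natl; congr (_ * _)%:E.
  rewrite (eq_card (B := predC1 j))//.
  have := cardC1 j; rewrite card_ord => ->.
  by rewrite -subn1 natrB ?expn_gt0.
have fl (f' : nat -> nat) (l' : 'I_(2 ^ n)) :
    (\int[P]_w ((f' (inc l' w))%:R%:E) = \int[P]_w ((f' (X (h n) w))%:R%:E))%E.
  by apply: integral_natr_eq_law => [||U]; [exact: minc|exact: mX|exact: inc_law].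
under eq_integral do rewrite natrM EFinM.
rewrite (@integral_independent2 _ _ _ P (fun w => f (inc j w)) (fun w => g (inc l w))).
- by rewrite !fl ef eg -EFinM.
- exact: measurable_nat_comp.
- exact: measurable_nat_comp.
- move=> U V; apply: (full_independent2 (f @^-1` U) (g @^-1` V)
    (grid_independent iX (n := n) (lexx 0) t0)).
  by rewrite eq_sym.
- by rewrite fl eg.
Qed.

Let mean (f : nat -> nat) := \sum_(1 <= j < k.+1) (f j)%:R * lam j.

Lemma integral_dyadic_sum_cvg :
  (\int[P]_w ((S f n w)%:R%:E))%E @[n --> \oo] --> (mean f * t)%:E.
Proof.
apply: (@cvg_near_eq _ (fun n => ((2 ^ n)%:R * e f n)%:E)); last first.
  by apply: nearW => n; rewrite integral_dyadic_sum.
apply: cvg_EFin; first exact: nearW.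
exact: (gcp_small_time_expectation gX t0 f0 fk).2.
Qed.

Lemma integral_dyadic_sum_mul_cvg :
  (\int[P]_w ((S f n w * S g n w)%N%:R%:E))%E @[n --> \oo] -->
  (mean (fun m => f m * g m)%N * t + mean f * mean g * t ^+ 2)%:E.
Proof.
(* The factor [2 ^ n - 1] is expanded so that only the convergent quantities [2 ^ n * e] and the
   vanishing [e g n] occur. *)
apply: (@cvg_near_eq _ (fun n => ((2 ^ n)%:R * e (fun m => f m * g m)%N n +
    ((2 ^ n)%:R * e f n) * ((2 ^ n)%:R * e g n) -
    ((2 ^ n)%:R * e f n) * e g n)%:E)); last first.
  by apply: nearW => n; rewrite integral_dyadic_sum_mul; congr (_%:E); ring.
apply: cvg_EFin; first exact: nearW.
have fg0 : (f 0 * g 0 = 0)%N by rewrite f0.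
have fgk m : (k < m)%N -> (f m * g m = f k.+1 * g k.+1)%N.
  by move=> km; rewrite fk// gk.
have H1 := (gcp_small_time_expectation gX t0 f0 fk).2.
have H2 := (gcp_small_time_expectation gX t0 g0 gk).2.
have H3 := (gcp_small_time_expectation gX t0 fg0 fgk).2.
have H4 := thin_cvg0 H2.
have -> : mean (fun m => f m * g m)%N * t + mean f * mean g * t ^+ 2 =
  mean (fun m => f m * g m)%N * t + (mean f * t) * (mean g * t) - (mean f * t) * 0.
  by rewrite mulr0 subr0; congr (_ + _); ring.
exact: (cvgB (cvgD H3 (cvgM H1 H2)) (cvgM H1 H4)).
Qed.

End Functions.

End DyadicMoments.

Section GCPMoments.
Context d (T : measurableType d) (R : realType) (P : probability T R).
Variables (k : nat) (lam : nat -> R) (X : R -> T -> nat).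
Hypothesis gX : generalized_counting_process P k lam X.

Let cX : counting_process X. Proof. by case: gX. Qed.
Let X0 w : X 0 w = 0%N. Proof. by case: gX. Qed.
Let mX u : 0 <= u -> measurable_fun setT (X u).
Proof. exact: counting_process_measurable. Qed.
Let pathX := counting_process_path cX.
Let k_gt0 : (0 < k)%N. Proof. by case: gX => -[]. Qed.

Variable t : R.
Hypothesis t0 : 0 <= t.

Let S c n w := dyadic_sum c (X ^~ w) 0 t n.

Let mS c n : measurable_fun setT (S c n).
Proof. exact: measurable_dyadic_sum. Qed.

Let S_nd c w : {homo S c ^~ w : m n / (m <= n)%N}.
Proof.
apply: homo_leq => [//|x y z|n]; first exact: leq_trans.
exact: dyadic_sumS.
Qed.

Let S_le c n w : (S c n w <= X t w)%N.
Proof. by have := dyadic_sum_le n c (pathX w) (lexx 0) t0; rewrite X0 subn0. Qed.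

Let S_small n w : (forall j : 'I_(2 ^ n),
    (X (grid 0 t n j.+1) w - X (grid 0 t n j) w <= k)%N) -> S k n w = X t w.
Proof.
move=> H; rewrite /S /dyadic_sum.
rewrite (eq_bigr (fun j : 'I_(2 ^ n) =>
  (X (grid 0 t n j.+1) w - X (grid 0 t n j) w)%N)) => [|j _]; last exact/minn_idPl.
rewrite -(big_mkord xpredT (fun j => X (grid 0 t n j.+1) w - X (grid 0 t n j) w)%N).
rewrite telescope_sumn; first by rewrite gridE grid0 X0 subn0.
by apply: homo_leq => [//|x y z|j]; [exact: leq_trans|apply: (path_le (pathX w));
  [exact: grid_ge|exact: grid_le]].
Qed.

Let mneq n : measurable [set w | S k n w <> X t w].
Proof.
exact: (measurable_fun_nat_rel (fun a b => a <> b) (mS k n) (mX t0)).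
Qed.

(** If no cell has an increment above [k], truncation is inactive and the sum telescopes to [X t];
    the bound is the union bound over cells. *)
Lemma prob_dyadic_sum_neq n : (P [set w | S k n w <> X t w] <=
  ((2 ^ n)%:R * fine (P [set w | (k < X (t / (2 ^ n)%:R) w)%N]))%:E)%E.
Proof.
pose F (j : 'I_(2 ^ n)) := [set w | (k < X (grid 0 t n j.+1) w - X (grid 0 t n j) w)%N].
have mF j : measurable (F j).
  apply: (@measurable_nat_preimage _ _ (fun w => _ - _)%N (fun m => (k < m)%N)).
  by apply: measurable_increment; rewrite // grid_ge.
apply: (@le_trans _ _ (P [set w | exists2 j, xpredT j & F j w])).
  apply: le_measure; rewrite ?inE.
  - exact: mneq.
  - rewrite (_ : [set w | _] = \bigcup_(j in [set j | xpredT j]) F j)//.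
    by apply: fin_bigcup_measurable; [exact: finite_finset|move=> j _; exact: mF].
  - move=> w /= H; apply: contrapT => nF; apply: H; apply: S_small => j.
    by rewrite leqNgt; apply/negP => kj; apply: nF; exists j.
apply: le_trans (prob_exists_le P _ mF) _.
have h0 : 0 <= t / (2 ^ n)%:R by rewrite divr_ge0.
rewrite (eq_bigr (fun=> (fine (P [set w | (k < X (t / (2 ^ n)%:R) w)%N]))%:E)) => [|j _].
  by rewrite sumEFin sumr_const card_ord -[X in (X%:E <= _)%E]mulr_natl.
rewrite fineK; last first.
  by apply: prob_fin; exact: (measurable_nat_preimage (fun m => (k < m)%N) (mX h0)).
have := grid_increment_law gX n j (fun m => (k < m)%N) (lexx 0) t0.
by rewrite subr0.
Qed.

(* Outside N, some dyadic mesh has no cell with an increment larger than k. *)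
Let N := \bigcap_n [set w | S k n w <> X t w].

Let mN : measurable N.
Proof. exact: bigcap_measurableType. Qed.

Let PN0 : P N = 0%E.
Proof.
apply/eqP; rewrite eq_le measure_ge0 andbT.
have H : ((2 ^ n)%:R * fine (P [set w | (k < X (t / (2 ^ n)%:R) w)%N]))%:E
    @[n --> \oo] --> (0 : R)%:E.
  by apply: cvg_EFin; [exact: nearW|exact: (gcp_rate_large gX t0)].
rewrite -[X in (_ <= X)%E](cvg_lim _ H)//; apply: lime_ge.
  by apply/cvg_ex; eexists; exact: H.
apply: nearW => n; apply: le_trans (prob_dyadic_sum_neq n).
by apply: le_measure; rewrite ?inE// => w; exact.
Qed.

(** Equality at one level [n0] persists, since the sums increase with the level and never exceed
    [X t]. *)
Let N_limit w : ~ N w -> \forall n \near \oo, S k n w = X t w.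
Proof.
move=> /existsNP[n0 /not_implyP[_ /contrapT Sn0]]; near=> n.
apply/eqP; rewrite eqn_leq S_le/= -Sn0; apply: S_nd.
by near: n; exact: nbhs_infty_ge.
Unshelve. all: by end_near. Qed.

(** Covers at once the jump count ([c = 1]) and the process ([c = k]), so that each moment formula
    is proved once for general truncations. *)
Definition dyadic_limit c (Z : T -> nat) := measurable_fun setT Z /\
  (forall w, ~ N w -> \forall n \near \oo, S c n w = Z w).

Lemma dyadic_limit_jump_count : dyadic_limit 1 (jump_count X t).
Proof.
split; first exact: (counting_process_measurable (counting_process_jump_count cX)).
by move=> w _; exact: dyadic_sum_cvg.
Qed.

Lemma dyadic_limit_process : dyadic_limit k (X t).
Proof. by split; [exact: mX|exact: N_limit]. Qed.

Definition truncated_mean c : R := \sum_(1 <= j < k.+1) (minn j c)%:R * lam j.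

Lemma integral_dyadic_limit c Z : (c <= k)%N -> dyadic_limit c Z ->
  (\int[P]_w ((Z w)%:R%:E) = (truncated_mean c * t)%:E)%E.
Proof.
move=> ck [mZ HZ].
have minnk n : (k < n)%N -> minn n c = minn k.+1 c.
  by move=> kn; rewrite !(minn_idPr _)// ?leqW// (leq_trans ck)// ltnW.
have H1 := integral_nat_limit (mS c) mZ (@S_nd c) mN PN0 HZ.
have H2 := integral_dyadic_sum_cvg gX t0 (min0n c) minnk.
exact: (cvg_unique _ H1 H2).
Qed.

Lemma integral_dyadic_limit_mul c c' Z Z' : (c <= k)%N -> (c' <= k)%N ->
  dyadic_limit c Z -> dyadic_limit c' Z' ->
  (\int[P]_w ((Z w * Z' w)%N%:R%:E) =
  ((\sum_(1 <= j < k.+1) (minn j c * minn j c')%:R * lam j) * t +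
   truncated_mean c * truncated_mean c' * t ^+ 2)%:E)%E.
Proof.
move=> ck ck' [mZ HZ] [mZ' HZ'].
have minnk b n : (b <= k)%N -> (k < n)%N -> minn n b = minn k.+1 b.
  by move=> bk kn; rewrite !(minn_idPr _)// ?leqW// (leq_trans bk)// ltnW.
have H1 := @integral_nat_limit _ _ _ P (fun n w => (S c n w * S c' n w)%N)
  (fun w => (Z w * Z' w)%N) N (fun n => measurable_fun_muln (mS c n) (mS c' n))
  (measurable_fun_muln mZ mZ')
  (fun w m n mn => leq_mul (@S_nd c w m n mn) (@S_nd c' w m n mn)) mN PN0.
have H2 := @integral_dyadic_sum_mul_cvg _ _ _ _ _ _ _ gX _ t0 _ _ (min0n c)
  (minnk c ^~ ck) (min0n c') (minnk c' ^~ ck').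
apply: (cvg_unique _ (H1 _) H2) => // w Nw; near=> n.
have -> : S c n w = Z w by near: n; exact: HZ.
by have -> : S c' n w = Z' w by near: n; exact: HZ'.
Unshelve. all: by end_near. Qed.

Let truncated_mean1 : truncated_mean 1 = total_rate k lam.
Proof.
rewrite /truncated_mean /total_rate big_nat [RHS]big_nat.
by apply: eq_bigr => j /andP[j1 _]; rewrite (minn_idPr _)// mul1r.
Qed.

Let truncated_meank : truncated_mean k = \sum_(1 <= j < k.+1) j%:R * lam j.
Proof.
rewrite /truncated_mean big_nat [RHS]big_nat.
by apply: eq_bigr => j /andP[_ jk]; rewrite (minn_idPl _).
Qed.

Local Notation A := (jump_count X t).

Lemma gcp_expectation_jump_count :
  (\int[P]_w ((A w)%:R%:E) = (total_rate k lam * t)%:E)%E.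
Proof.
by rewrite (integral_dyadic_limit k_gt0 dyadic_limit_jump_count) truncated_mean1.
Qed.

Lemma gcp_expectation :
  (\int[P]_w ((X t w)%:R%:E) = ((\sum_(1 <= j < k.+1) j%:R * lam j) * t)%:E)%E.
Proof.
by rewrite (integral_dyadic_limit (leqnn k) dyadic_limit_process) truncated_meank.
Qed.

Lemma gcp_expectation_jump_count_mul :
  (\int[P]_w ((A w * X t w)%N%:R%:E) =
   ((\sum_(1 <= j < k.+1) j%:R * lam j) * t +
    total_rate k lam * (\sum_(1 <= j < k.+1) j%:R * lam j) * t ^+ 2)%:E)%E.
Proof.
rewrite (integral_dyadic_limit_mul k_gt0 (leqnn k) dyadic_limit_jump_count
  dyadic_limit_process) truncated_mean1 truncated_meank.
congr ((_ * _ + _)%:E); rewrite big_nat [RHS]big_nat.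
apply: eq_bigr => j /andP[j1 jk].
by rewrite (minn_idPr j1) mul1n (minn_idPl _).
Qed.

Lemma gcp_second_moment_jump_count :
  (\int[P]_w ((A w * A w)%N%:R%:E) =
   (total_rate k lam * t + (total_rate k lam * t) ^+ 2)%:E)%E.
Proof.
rewrite (integral_dyadic_limit_mul k_gt0 k_gt0 dyadic_limit_jump_count
  dyadic_limit_jump_count) truncated_mean1 -expr2 -exprMn.
congr ((_ * _ + _)%:E); rewrite big_nat [RHS]big_nat.
apply: eq_bigr => j /andP[j1 jk].
by rewrite (minn_idPr j1) muln1 mul1r.
Qed.

Lemma gcp_second_moment :
  (\int[P]_w ((X t w * X t w)%N%:R%:E) =
   ((\sum_(1 <= j < k.+1) j%:R ^+ 2 * lam j) * t +
    ((\sum_(1 <= j < k.+1) j%:R * lam j) * t) ^+ 2)%:E)%E.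
Proof.
rewrite (integral_dyadic_limit_mul (leqnn k) (leqnn k) dyadic_limit_process
  dyadic_limit_process) truncated_meank -expr2 -exprMn.
congr ((_ * _ + _)%:E); rewrite big_nat [RHS]big_nat.
apply: eq_bigr => j /andP[j1 jk].
by rewrite (minn_idPl _)// natrM -expr2.
Qed.

End GCPMoments.

(** * Superposition of independent GCPs *)

Section NatLaws.
Context d (T : measurableType d) (R : realType) (P : probability T R).

Lemma prob_eq_null (A B N : set T) : measurable A -> measurable B ->
  measurable N -> P N = 0%E -> (forall w, ~ N w -> A w <-> B w) -> P A = P B.
Proof.
move=> mA mB mN PN AB.
have PI (C : set T) : measurable C -> P C = P (C `\` N).
  move=> mC; have mCN := measurableI _ _ mC mN.
  have CN0 : P (C `&` N) = 0%E.
    by apply/eqP; rewrite eq_le measure_ge0 andbT -PN le_measure ?inE// => w [].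
  rewrite -[in LHS](setUIDK C N) measureU//; last 2 first.
  - exact: measurableD.
  - by apply/seteqP; split => w // [[_ ?] [_ ?]].
  by rewrite -[RHS]add0e; congr (_ + _)%E; exact: CN0.
rewrite (PI A)// (PI B)//; congr (P _).
by apply/seteqP; split => w [Cw Nw]; split=> //; apply/(AB w Nw).
Qed.

(** As [u] may be negative, convergence is dominated rather than monotone: the truncations [f n],
    which drop the values [X >= n], are bounded by 1 in absolute value. *)
Lemma poisson_pgf (X : T -> nat) (x u : R) : measurable_fun setT X ->
  (forall a, P [set w | X w = a] = (poisson_weight x a)%:E) -> `|u| <= 1 ->
  (\int[P]_w ((u ^+ X w)%:E) = (expR (- (x * (1 - u))))%:E)%E.
Proof.
move=> mX HX u1.
have msX (U : set nat) := measurable_nat_preimage U mX.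
have mh (h : nat -> R) : measurable_fun setT (fun w => (h (X w))%:E).
  apply/measurable_EFinP; exact: (@measurableT_comp _ _ _ _ _ _ h).
pose f n w := (\sum_(a < n) u ^+ a * \1_[set w | X w = a] w).
have fE n w : f n w = if (X w < n)%N then u ^+ X w else 0.
  have ind a : \1_[set w | X w = a] w = (X w == a)%:R :> R.
    rewrite indicE; congr ((nat_of_bool _)%:R).
    by apply/idP/eqP => [/set_mem//|/mem_set].
  case: ifPn => Xn.
    rewrite /f (bigD1 (Ordinal Xn))//= ind eqxx mulr1 big1 ?addr0// => a aX.
    by rewrite ind eq_sym [X in X%:R](_ : _ = 0%N) ?mulr0//; move: aX;
      rewrite -val_eqE/= => /negPf ->.
  rewrite /f big1// => a _; rewrite ind gtn_eqF ?mulr0//.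
  by rewrite (leq_trans (ltn_ord a))// leqNgt.
have intf n : (\int[P]_w ((f n w)%:E) =
    (\sum_(a < n) u ^+ a * poisson_weight x a)%:E)%E.
  under eq_integral do rewrite -sumEFin.
  rewrite integral_sum//; last first.
    move=> a; under eq_fun do rewrite EFinM.
    by apply: integrableZl => //; apply: integrable_indic; exact: (msX [set (a : nat)]).
  rewrite -sumEFin; apply: eq_bigr => a _.
  under eq_integral do rewrite EFinM.
  rewrite integralZl//; last by apply: integrable_indic; exact: (msX [set (a : nat)]).
  rewrite integral_indic//; last exact: (msX [set (a : nat)]).
  by rewrite setIT EFinM; congr (_ * _)%E; exact: HX.
have H1 : (\int[P]_w ((f n w)%:E))%E @[n --> \oo] --> (\int[P]_w ((u ^+ X w)%:E))%E.
  have [|||||_ _ //] := @dominated_convergence _ _ _ P setT measurableT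
    (fun n w => (f n w)%:E) (fun w => (u ^+ X w)%:E) (cst 1%E).
  - move=> n; under eq_fun do rewrite fE.
    exact: (mh (fun m => if (m < n)%N then u ^+ m else 0)).
  - exact: (mh (fun m => u ^+ m)).
  - apply: aeW => w _; apply: (@cvg_near_eq _ (fun=> (u ^+ X w)%:E)).
      exact: cvg_cst.
    near=> n; rewrite fE ifT//.
    by near: n; exact: nbhs_infty_gt.
  - exact: finite_measure_integrable_cst.
  - apply: aeW => w n _; rewrite fE /= lee_fin.
    by case: ifP => _; rewrite ?normr0// normrX exprn_ile1.
apply: (cvg_unique _ H1) => //.
have -> : expR (- (x * (1 - u))) = expR (u * x) * expR (- x).
  by rewrite -expRD; congr expR; ring.
apply: (@cvg_near_eq _ (fun n => (series (exp_coeff (u * x)) n * expR (- x))%:E)).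
  apply: cvg_EFin; first exact: nearW.
  by apply: cvgM; [exact: is_cvg_series_exp_coeff|exact: cvg_cst].
apply: nearW => n; rewrite intf /series/= big_mkord mulr_suml; congr (_%:E).
by apply: eq_bigr => a _; rewrite /poisson_weight /exp_coeff/= exprMn; ring.
Unshelve. all: by end_near. Qed.

Lemma nat_Lfun1 (X : T -> nat) (c : R) : measurable_fun setT X ->
  (\int[P]_w ((X w)%:R%:E) = c%:E)%E -> (fun w => (X w)%:R : R) \in Lfun P 1.
Proof.
move=> mX Xc; apply/Lfun1_integrable/integrableP; split.
  exact: measurable_natr_EFin.
rewrite (eq_integral (fun w => (X w)%:R%:E)) ?Xc ?ltry// => w _.
by rewrite /= ger0_norm.
Qed.

Lemma covariance_nat (X Y : T -> nat) (x y z : R) :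
  measurable_fun setT X -> measurable_fun setT Y ->
  (\int[P]_w ((X w)%:R%:E) = x%:E)%E -> (\int[P]_w ((Y w)%:R%:E) = y%:E)%E ->
  (\int[P]_w ((X w * Y w)%N%:R%:E) = z%:E)%E ->
  covariance P (fun w => (X w)%:R) (fun w => (Y w)%:R) = (z - x * y)%:E.
Proof.
move=> mX mY Xx Yy XYz.
have XYE : ((fun w => (X w)%:R) * (fun w => (Y w)%:R))%R =
    (fun w => (X w * Y w)%N%:R) :> (T -> R).
  by apply/funext => w; rewrite natrM.
rewrite covarianceE; last 3 first.
- exact: nat_Lfun1 mX Xx.
- exact: nat_Lfun1 mY Yy.
- rewrite XYE; apply: nat_Lfun1 XYz; exact: measurable_fun_muln.
by rewrite XYE unlock Xx Yy XYz.
Qed.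

End NatLaws.

Lemma binomial_prob_set1 (R : realType) n a (p : R) : 0 <= p <= 1 ->
  binomial_prob n p [set a] = (p ^+ a * (1 - p) ^+ (n - a) *+ 'C(n, a))%:E.
Proof.
by move=> p01; rewrite /binomial_prob p01 esum_set1// lee_fin binomial_pmf_ge0.
Qed.

Section SuperposedGCPs.
Context d (T : measurableType d) (R : realType) (P : probability T R).
Variables (I : finType) (M : I -> R -> T -> nat) (k : I -> nat) (lam : I -> nat -> R).
Hypotheses (hM : forall i, generalized_counting_process P (k i) (lam i) (M i))
           (hind : independent_processes P M).

Let rate i := total_rate (k i) (lam i).

Let cM i : counting_process (M i). Proof. by case: (hM i). Qed.
Let iM i : independent_increments P (M i). Proof. by case: (hM i) => _ _ _ []. Qed.
Let HL i : has_jump_rate P (M i) (rate i).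
Proof. exact: gcp_has_jump_rate (hM i). Qed.

Let A i := jump_count (M i).
Let S (J : pred I) := partial_sum_process M J.

Let rate_gt0 i : 0 < rate i. Proof. exact: total_rate_gt0 (hM i). Qed.

Let cS J : counting_process (S J).
Proof. exact: counting_process_partial_sum. Qed.

Let mA i t : 0 <= t -> measurable_fun setT (A i t).
Proof. exact: (counting_process_measurable (counting_process_jump_count (cM i))). Qed.

Let mAS J t : 0 <= t -> measurable_fun setT (jump_count (S J) t).
Proof. exact: (counting_process_measurable (counting_process_jump_count (cS J))). Qed.

Let mAsum (J : pred I) t : 0 <= t ->
  measurable_fun setT (fun w => \sum_(i | J i) A i t w)%N.
Proof. by move=> t0; apply: measurable_fun_sumn => i; exact: mA. Qed.

Lemma poisson_process_superposition (J : pred I) i0 : J i0 ->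
  poisson_process P (\sum_(i | J i) rate i) (jump_count (S J)).
Proof.
move=> Ji0; apply: poisson_process_jump_count.
- exact: cS.
- exact: independent_increments_partial_sum.
- by rewrite (bigD1 i0)//= ltr_wpDr// sumr_ge0// => i _; exact: ltW.
- exact: has_jump_rate_partial_sum.
Qed.

Lemma jump_count_weight i t a : 0 <= t ->
  P [set w | A i t w = a] = (poisson_weight (rate i * t) a)%:E.
Proof.
move=> t0; have := @jumpn_law _ _ _ P _ (cM i) (@iM i) _ _ _ a (@HL i) (lexx 0) t0.
by rewrite subr0.
Qed.

Lemma superposition_weight J t a : 0 <= t ->
  P [set w | jump_count (S J) t w = a] =
  (poisson_weight ((\sum_(i | J i) rate i) * t) a)%:E.
Proof.
move=> t0; have := @jumpn_law _ _ _ P _ (cS J)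
  (independent_increments_partial_sum cM (@iM) hind (J := J)) _ _ _ a
  (has_jump_rate_partial_sum cM hind (@HL) J) (lexx 0) t0.
by rewrite subr0.
Qed.

Let independent_counts t : 0 <= t -> full_independent P (fun i => A i t).
Proof.
move=> t0; apply: (independent_processes_rvs
  (independent_processes_jump_count cM hind)) => i U.
by apply: process_sigma_preimage; exact: process_sigma_self.
Qed.

(** Two blocks indexed by [bool]: component [i] alone, and all the others. *)
Let independent_rest i t (U V : set nat) : 0 <= t ->
  P [set w | U (A i t w) /\ V (\sum_(j | j != i) A j t w)%N] =
  (P [set w | U (A i t w)] * P [set w | V (\sum_(j | j != i) A j t w)%N])%E.
Proof.
move=> t0.
have H := full_independent_block_sums (fun j => j == i) (fun _ => id)
  (fun j => @mA j t t0) (independent_counts t0).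
have Htrue w : (\sum_(j | (j == i) == true) A j t w)%N = A i t w.
  by rewrite (eq_bigl (pred1 i)) ?big_pred1_eq// => j; rewrite eqb_id.
have Hfalse w : (\sum_(j | (j == i) == false) A j t w)%N =
    (\sum_(j | j != i) A j t w)%N.
  by apply: eq_bigl => j; rewrite eqbF_neg.
have := full_independent2 U V H (isT : true != false).
under eq_set do rewrite Htrue Hfalse.
move=> ->; congr (P _ * P _)%E; first by under eq_set do rewrite Htrue.
by under eq_set do rewrite Hfalse.
Qed.

Let null J t := [set w | jump_count (S J) t w <> (\sum_(i | J i) A i t w)%N].

Let mnull J t : 0 <= t -> measurable (null J t).
Proof.
move=> t0.
exact: (measurable_fun_nat_rel (fun a b => a <> b) (@mAS J t t0) (@mAsum J t t0)).
Qed.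

Let Pnull J t : 0 <= t -> P (null J t) = 0%E.
Proof. exact: (jump_count_partial_sum cM hind (@HL)). Qed.

(** Almost surely this sum is the jump count of the process that sums the components other than [i],
    whose law is known; no convolution of Poisson laws is computed. *)
Lemma rest_weight i t a : 0 <= t ->
  P [set w | (\sum_(j | j != i) A j t w)%N = a] =
  (poisson_weight ((\sum_(j | j != i) rate j) * t) a)%:E.
Proof.
move=> t0; rewrite -(superposition_weight (fun j => j != i) a t0).
apply: (prob_eq_null _ _ (@mnull (fun j => j != i) t t0) (@Pnull _ t t0)).
- exact: (measurable_nat_preimage [set a] (@mAsum (fun j => j != i) t t0)).
- exact: (measurable_nat_preimage [set a] (@mAS _ t t0)).
- by move=> w /contrapT /= ->.
Qed.

(** Once [A i t = a], the condition on the total bears, off a null set, on the other components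
    alone, which are independent of [A i t]. *)
Lemma joint_count_weight i t a b : 0 <= t ->
  P [set w | A i t w = a /\ jump_count (S xpredT) t w = b] =
  (if (a <= b)%N then poisson_weight (rate i * t) a *
     poisson_weight ((\sum_(j | j != i) rate j) * t) (b - a) else 0)%:E.
Proof.
move=> t0.
have -> : P [set w | A i t w = a /\ jump_count (S xpredT) t w = b] =
    P [set w | A i t w = a /\ (a + \sum_(j | j != i) A j t w)%N = b].
  apply: (prob_eq_null _ _ (@mnull xpredT t t0) (@Pnull _ t t0)).
  - exact: (measurable_fun_nat_rel (fun x y => x = a /\ y = b) (@mA i t t0) (@mAS _ t t0)).
  - exact: (measurable_fun_nat_rel (fun x y => x = a /\ (a + y)%N = b) (@mA i t t0)
      (@mAsum (fun j => j != i) t t0)).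
  - move=> w /contrapT /= ->; rewrite (bigD1 i)//=.
    by split=> -[Aa <-]; rewrite Aa.
rewrite (@independent_rest i t [set a] (fun m => (a + m)%N = b) t0).
rewrite jump_count_weight//; case: ifPn => ab.
  rewrite [RHS]EFinM; congr (_ * _)%E; rewrite -rest_weight//; congr (P _).
  by apply/seteqP; split => w /= H; [rewrite -H addKn|rewrite H subnKC].
rewrite (_ : [set w | _] = set0) ?measure0 ?mule0//.
by apply/seteqP; split=> // w /= H; move: ab; rewrite -H leq_addr.
Qed.

Let total := \sum_i rate i.

Let totalD1 i : total = rate i + \sum_(j | j != i) rate j.
Proof. by rewrite /total (bigD1 i). Qed.

Let total_gt0 (i : I) : 0 < total.
Proof. by rewrite (totalD1 i) ltr_wpDr// sumr_ge0// => j _; exact: ltW. Qed.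

(** Exponentials and powers of [t] cancel, because the rates add up to [total] and the exponents [a]
    and [b - a] to [b]. *)
Let weight_ratio i t a b : 0 < t -> (a <= b)%N ->
  poisson_weight (rate i * t) a * poisson_weight ((\sum_(j | j != i) rate j) * t) (b - a)
   / poisson_weight (total * t) b =
  b`!%:R / (a`!%:R * (b - a)`!%:R) * (rate i ^+ a / total ^+ b)
    * (\sum_(j | j != i) rate j) ^+ (b - a).
Proof.
move=> t0 ab; have tot0 := total_gt0 i; set r := \sum_(j | j != i) rate j.
have fact0 m : m`!%:R != 0 :> R by rewrite pnatr_eq0 -lt0n fact_gt0.
have expE : expR (- (total * t)) = expR (- (rate i * t)) * expR (- (r * t)).
  have totr : total = rate i + r := totalD1 i.
  by rewrite -expRD totr; congr expR; ring.
have tb : t ^+ b = t ^+ a * t ^+ (b - a) by rewrite -exprD subnKC.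
rewrite /poisson_weight expE !exprMn tb; field.
by rewrite !fact0 !expf_neq0 ?gt_eqF ?expR_gt0.
Qed.

Lemma conditional_count i t a b : 0 < t -> (a <= b)%N ->
  cond_pr P [set w | A i t w = a] [set w | jump_count (S xpredT) t w = b] =
  b`!%:R / (a`!%:R * (b - a)`!%:R) * (rate i ^+ a / total ^+ b)
    * (\sum_(j | j != i) rate j) ^+ (b - a).
Proof.
move=> t0 ab; rewrite -(@weight_ratio i t)// /cond_pr.
rewrite (joint_count_weight i a b (ltW t0)) ab.
by rewrite (superposition_weight xpredT b (ltW t0)).
Qed.

Lemma conditional_count_binomial i t b (U : set nat) : 0 < t ->
  (cond_pr P [set w | U (A i t w)] [set w | jump_count (S xpredT) t w = b])%:E =
  binomial_prob b (rate i / total) U.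
Proof.
move=> t0; set B := [set w | _ = b].
have mB : measurable B.
  exact: (measurable_nat_preimage [set b] (@mAS xpredT t (ltW t0))).
have mU (V : set nat) : measurable [set w | V (A i t w)].
  exact: (measurable_nat_preimage V (@mA i t (ltW t0))).
have c0 : 0 <= (fine (P B))^-1 by rewrite invr_ge0 fine_ge0.
(* Conditioning on [B] as a genuine measure, the rescaled restriction of [P], so that only point
   masses have to be compared. *)
pose mu := mscale (NngNum c0) (mrestr P mB).
have muE V : (cond_pr P [set w | V (A i t w)] B)%:E = mu [set w | V (A i t w)].
  rewrite /mu /mscale /mrestr/= /cond_pr mulrC EFinM fineK//.
  by apply: prob_fin; exact: measurableI.
have tot0 := total_gt0 i.
have rest0 : 0 <= \sum_(j | j != i) rate j by rewrite sumr_ge0// => j _; exact: ltW.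
have p01 : 0 <= rate i / total <= 1.
  rewrite divr_ge0 ?(ltW (rate_gt0 i)) ?(ltW tot0)//=.
  by rewrite ler_pdivrMr// mul1r (totalD1 i) lerDl.
rewrite muE; apply: (@eq_nat_measures _ _ _ mu (binomial_prob b (rate i / total))).
  exact: (@mA i t (ltW t0)).
move=> a; transitivity (cond_pr P [set w | A i t w = a] B)%:E.
  exact: (esym (muE [set a])).
apply: etrans _ (esym (binomial_prob_set1 b a p01)).
(* For [a > b] both sides vanish: the binomial coefficient is 0, and almost surely a component does
   not jump more often than the sum. *)
congr (_%:E); have [ab|ba] := leqP a b; last first.
  rewrite bin_small// mulr0n /cond_pr.
  rewrite (joint_count_weight i a b (ltW t0)).
  by rewrite leqNgt ba/= mul0r.
rewrite [LHS](conditional_count i t0 ab).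
have -> : 1 - rate i / total = (\sum_(j | j != i) rate j) / total.
  by rewrite {1}(totalD1 i) (totalD1 i); field; rewrite -(totalD1 i) gt_eqF.
have tb : total ^+ b = total ^+ a * total ^+ (b - a) by rewrite -exprD subnKC.
have fact0 m : m`!%:R != 0 :> R by rewrite pnatr_eq0 -lt0n fact_gt0.
have binE : 'C(b, a)%:R = b`!%:R / (a`!%:R * (b - a)`!%:R) :> R.
  by rewrite -(bin_fact ab) !natrM; field; rewrite !fact0.
rewrite -[RHS]mulr_natl binE !exprMn tb !exprVn; field.
by rewrite !fact0 !expf_neq0// gt_eqF.
Qed.

End SuperposedGCPs.

(** * Covariance and correlation in the superposition *)

Section SuperposedMoments.
Context d (T : measurableType d) (R : realType) (P : probability T R).

Lemma integral_natr_sum (I : Type) (r : seq I) (X : I -> T -> nat) :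
  (forall i, measurable_fun setT (X i)) ->
  (\int[P]_w ((\sum_(i <- r) X i w)%N%:R%:E) =
   \sum_(i <- r) \int[P]_w ((X i w)%:R%:E))%E.
Proof.
move=> mX; rewrite -ge0_integral_sum//; last first.
  by move=> i; exact: measurable_natr_EFin.
by apply: eq_integral => w _; rewrite sumEFin natr_sum.
Qed.

Variables (I : finType) (M : I -> R -> T -> nat) (k : I -> nat) (lam : I -> nat -> R).
Hypotheses (hM : forall i, generalized_counting_process P (k i) (lam i) (M i))
           (hind : independent_processes P M).

Let rate i := total_rate (k i) (lam i).
Let mean i := \sum_(1 <= j < (k i).+1) j%:R * lam i j.
Let square i := \sum_(1 <= j < (k i).+1) j%:R ^+ 2 * lam i j.
Let A i := jump_count (M i).
Let S := partial_sum_process M xpredT.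

Let cM i : counting_process (M i). Proof. by case: (hM i). Qed.

Variable t : R.
Hypothesis t0 : 0 <= t.

Let mM i : measurable_fun setT (M i t).
Proof. exact: (counting_process_measurable (cM i)). Qed.

Let mA i : measurable_fun setT (A i t).
Proof. exact: (counting_process_measurable (counting_process_jump_count (cM i))). Qed.

Let mS : measurable_fun setT (S t).
Proof. exact: (counting_process_measurable (counting_process_partial_sum cM xpredT)). Qed.

Let expectation_mul_independent (X : I -> T -> nat) i j (x y : R) :
  (forall i U, process_sigma (M i) [set w | U (X i w)]) ->
  (forall i, measurable_fun setT (X i)) -> i != j ->
  (\int[P]_w ((X i w)%:R%:E) = x%:E)%E -> (\int[P]_w ((X j w)%:R%:E) = y%:E)%E ->
  (\int[P]_w ((X i w * X j w)%N%:R%:E) = (x * y)%:E)%E.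
Proof.
move=> sX mX ij Xx Xy; have HX := independent_processes_rvs hind sX.
under eq_integral do rewrite natrM EFinM.
rewrite integral_independent2//; last by rewrite Xy.
  by rewrite Xx Xy.
by move=> U V; exact: (full_independent2 U V HX ij).
Qed.

Let sigma_process i U : process_sigma (M i) [set w | U (M i t w)].
Proof. by apply: process_sigma_preimage; exact: process_sigma_self. Qed.

Let sigma_count i U : process_sigma (M i) [set w | U (A i t w)].
Proof.
apply: (process_sigma_jump_count (cM i)).
by apply: process_sigma_preimage; exact: process_sigma_self.
Qed.

Let count_process_independent i j : i != j ->
  (\int[P]_w ((A i t w * M j t w)%N%:R%:E) = ((rate i * t) * (mean j * t))%:E)%E.
Proof.
(* A mixed family, the count at index [i] and the processes elsewhere, so that independence of a
   single family indexed by [I] applies. *)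
move=> ij; pose X l := if l == i then A l t else M l t.
have Xi : X i = A i t by rewrite /X eqxx.
have Xj : X j = M j t by rewrite /X eq_sym (negPf ij).
rewrite -Xi -Xj; apply: (expectation_mul_independent _ _ ij).
- by move=> l U; rewrite /X; case: eqP => _; [exact: sigma_count|exact: sigma_process].
- by move=> l; rewrite /X; case: eqP => _; [exact: mA|exact: mM].
- by rewrite Xi; exact: (gcp_expectation_jump_count (hM i) t0).
- by rewrite Xj; exact: (gcp_expectation (hM j) t0).
Qed.

Lemma expectation_superposition :
  (\int[P]_w ((S t w)%:R%:E) = ((\sum_i mean i) * t)%:E)%E.
Proof.
rewrite integral_natr_sum// mulr_suml -sumEFin; apply: eq_bigr => i _.
exact: (gcp_expectation (hM i) t0).
Qed.

Lemma expectation_count_mul_superposition i :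
  (\int[P]_w ((A i t w * S t w)%N%:R%:E) =
   (mean i * t + rate i * (\sum_m mean m) * t ^+ 2)%:E)%E.
Proof.
under eq_integral do rewrite big_distrr/=.
rewrite integral_natr_sum => [|j]; last exact: measurable_fun_muln.
rewrite (bigD1 i)//= (gcp_expectation_jump_count_mul (hM i) t0).
rewrite (eq_bigr (fun j => ((rate i * t) * (mean j * t))%:E)); last first.
  by move=> j ji; apply: count_process_independent; rewrite eq_sym.
rewrite sumEFin -EFinD [in RHS](bigD1 i)//= -mulr_sumr -mulr_suml.
by congr (_%:E); rewrite -/(mean i) -/(rate i); ring.
Qed.

Lemma second_moment_superposition :
  (\int[P]_w ((S t w * S t w)%N%:R%:E) =
   ((\sum_i square i) * t + ((\sum_i mean i) * t) ^+ 2)%:E)%E.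
Proof.
under eq_integral do rewrite big_distrl/=.
rewrite integral_natr_sum => [|i]; last by apply: measurable_fun_muln => //; exact: mS.
(* Row [i] of the double sum: the diagonal term gives [square i * t] and the square of [mean i * t];
   the off-diagonal terms complete that square to the product with the total mean. *)
rewrite (eq_bigr (fun i => (square i * t + (mean i * t) * ((\sum_j mean j) * t))%:E)).
  rewrite sumEFin big_split/= -!mulr_suml.
  by congr (_%:E); ring.
move=> i _; under eq_integral do rewrite big_distrr/=.
rewrite integral_natr_sum => [|j]; last exact: measurable_fun_muln.
rewrite (bigD1 i)//= (gcp_second_moment (hM i) t0).
rewrite (eq_bigr (fun j => ((mean i * t) * (mean j * t))%:E)); last first.
  move=> j ji; apply: (@expectation_mul_independent (fun l => M l t)) => //.
  - by rewrite eq_sym.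
  - exact: (gcp_expectation (hM i) t0).
  - exact: (gcp_expectation (hM j) t0).
rewrite sumEFin -EFinD [in RHS](bigD1 i)//= -mulr_sumr -mulr_suml.
by congr (_%:E); rewrite -/(mean i) -/(square i); ring.
Qed.

Lemma covariance_count_superposition i :
  covariance P (fun w => (A i t w)%:R) (fun w => (S t w)%:R) = (mean i * t)%:E.
Proof.
rewrite (covariance_nat (mA i) mS (gcp_expectation_jump_count (hM i) t0)
  expectation_superposition (expectation_count_mul_superposition i)).
by congr (_%:E); rewrite -/(rate i); ring.
Qed.

Lemma variance_count i : variance P (fun w => (A i t w)%:R) = (rate i * t)%:E.
Proof.
have EA := gcp_expectation_jump_count (hM i) t0.
rewrite /variance (covariance_nat (mA i) (mA i) EA EA
  (gcp_second_moment_jump_count (hM i) t0)).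
by congr (_%:E); rewrite -/(rate i); ring.
Qed.

Lemma variance_superposition :
  variance P (fun w => (S t w)%:R) = ((\sum_i square i) * t)%:E.
Proof.
rewrite /variance (covariance_nat mS mS expectation_superposition
  expectation_superposition second_moment_superposition).
by congr (_%:E); ring.
Qed.

Lemma correlation_count_superposition i : 0 < t ->
  correlation P (fun w => (A i t w)%:R) (fun w => (S t w)%:R) =
  mean i / (Num.sqrt (rate i) * Num.sqrt (\sum_i square i)).
Proof.
move=> t_gt0; rewrite /correlation covariance_count_superposition variance_count.
rewrite variance_superposition/=.
have rate0 : 0 <= rate i by apply/ltW; exact: total_rate_gt0 (hM i).
have square0 : 0 <= \sum_i square i.
  apply: sumr_ge0 => l _; rewrite /square big_nat sumr_ge0// => j jk.
  have [[_ lam0] _ _ _ _] := hM l.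
  by rewrite mulr_ge0 ?exprn_ge0// ltW// lam0.
(* The two factors [Num.sqrt t] of the denominator recombine into [t], which cancels that of the
   covariance. *)
rewrite !sqrtrM// mulrACA -expr2 sqr_sqrtr; last exact: ltW.
by rewrite -mulf_div divff ?mulr1// gt_eqF.
Qed.

End SuperposedMoments.

Lemma big_nat_extend0 (V : nmodType) (F : nat -> V) a b : (a <= b)%N ->
  (forall j, (a < j)%N -> F j = 0) ->
  \sum_(1 <= j < a.+1) F j = \sum_(1 <= j < b.+1) F j.
Proof.
move=> ab F0; rewrite [RHS](@big_cat_nat _ _ _ a.+1)//=.
rewrite [X in _ = _ + X](_ : _ = 0) ?addr0// big_nat big1// => j /andP[aj _].
exact: F0.
Qed.

(* There are q.+1 >= 1 components; 'I_q.+1 indexes them and ord_max is the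
   last one. *)
Theorem mainTheorem3 (R : realType) (d : measure_display)
  (T : measurableType d) (P : probability T R)
  (q : nat) (M : 'I_q.+1 -> R -> T -> nat)
  (k : 'I_q.+1 -> nat) (lam : 'I_q.+1 -> nat -> R)
  (hM : forall i, generalized_counting_process P (k i) (lam i) (M i))
  (hind : independent_processes P M)
  (hk : forall i j : 'I_q.+1, (i <= j)%N -> (k i <= k j)%N)
  (hlam : forall i j, (k i < j)%N -> lam i j = 0) :
  let Mq : R -> T -> nat := sum_process M in
  let A (i : 'I_q.+1) : R -> T -> nat := jump_count (M i) in
  let Aq : R -> T -> nat := jump_count Mq in
  let rate (i : 'I_q.+1) : R := total_rate (k i) (lam i) in
  [/\ (* (1) *)
      [/\ forall (i : 'I_q.+1) (u t : R), `|u| <= 1 -> 0 <= t ->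
            ('E_P[(fun w => (u ^+ A i t w)%R)]
              = (expR (- (rate i * t * (1 - u))))%R%:E)%E,
          forall i : 'I_q.+1, poisson_process P (rate i) (A i)
        & independent_processes P A],
      (* (2) *)
      poisson_process P (\sum_(i < q.+1) rate i) Aq,
      (* (3) *)
      forall (i : 'I_q.+1) (t : R), 0 < t ->
        (forall a b : nat, (a <= b)%N ->
          cond_pr P [set w | A i t w = a] [set w | Aq t w = b] =
          b`!%:R / (a`!%:R * (b - a)`!%:R)
          * (rate i ^+ a / (\sum_(j < q.+1) rate j) ^+ b)
          * (\sum_(j < q.+1 | j != i) rate j) ^+ (b - a))
        /\ (forall (b : nat) (U : set nat),
          (cond_pr P [set w | U (A i t w)] [set w | Aq t w = b])%:E =
          binomial_prob b (rate i / \sum_(j < q.+1) rate j) U)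
    & (* (4) *)
      forall i : 'I_q.+1,
        [/\ forall t : R, 0 <= t ->
              ('E_P[(fun w => (A i t w)%:R * (Mq t w)%:R)%R] =
               (\sum_(1 <= j < (k i).+1) j%:R * lam i j * t
                + rate i * (\sum_(1 <= l < (k ord_max).+1)
                    \sum_(m < q.+1) l%:R * lam m l) * t ^+ 2)%R%:E)%E,
            forall t : R, 0 <= t ->
              covariance P (fun w => (A i t w)%:R) (fun w => (Mq t w)%:R) =
               (\sum_(1 <= j < (k i).+1) j%:R * lam i j * t)%:E
          & forall t : R, 0 < t ->
              correlation P (fun w => (A i t w)%:R) (fun w => (Mq t w)%:R) =
               (\sum_(1 <= j < (k i).+1) j%:R * lam i j)
               / (Num.sqrt (rate i) *
                  Num.sqrt (\sum_(1 <= j < (k ord_max).+1)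
                    \sum_(m < q.+1) j%:R ^+ 2 * lam m j))]].

Proof.
move=> Mq A Aq rate.
have cM i : counting_process (M i) by case: (hM i).
have MqE : Mq = partial_sum_process M xpredT by [].
have AqE : Aq = jump_count (partial_sum_process M xpredT) by [].
have kmax i : (k i <= k ord_max)%N by apply: hk; rewrite -ltnS ltn_ord.
(* Padding with zero rates lets every component be summed up to the largest amplitude, so the two
   sums can be exchanged. *)
have extend (F : nat -> R) :
    \sum_(1 <= j < (k ord_max).+1) \sum_(m < q.+1) F j * lam m j =
    \sum_(m < q.+1) \sum_(1 <= j < (k m).+1) F j * lam m j.
  rewrite exchange_big/=; apply: eq_bigr => m _; apply/esym/big_nat_extend0 => // j kj.
  by rewrite hlam// mulr0.
have mA i t : 0 <= t -> measurable_fun setT (A i t).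
  exact: (counting_process_measurable (counting_process_jump_count (cM i))).
split.
- split.
  + move=> i u t u1 t0; rewrite unlock.
    apply: poisson_pgf => // [|a]; first exact: mA.
    exact: jump_count_weight.
  + move=> i; apply: poisson_process_jump_count => //.
    * by case: (hM i) => _ _ _ [].
    * exact: total_rate_gt0 (hM i).
    * exact: gcp_has_jump_rate (hM i).
  + exact: independent_processes_jump_count.
(* [ord0] witnesses that the family is nonempty, hence that the total rate is positive. *)
- by rewrite AqE; apply: (poisson_process_superposition hM hind (i0 := ord0)).
- move=> i t t0; split=> [a b ab|b U]; rewrite AqE.
    exact: conditional_count.
  exact: conditional_count_binomial.
- move=> i; split=> t t0; rewrite MqE.
  + rewrite unlock; under eq_integral do rewrite -natrM.
    rewrite (expectation_count_mul_superposition hM hind t0 i).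
    by rewrite (extend (fun l => l%:R)) -mulr_suml.
  + by rewrite -mulr_suml; exact: covariance_count_superposition.
  + rewrite (extend (fun l => l%:R ^+ 2)).
    by apply: correlation_count_superposition => //; exact: ltW.
Qed.
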